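(* Let $k$ be a field of characteristic $0$, let $\nu\ge 1$, and let $\Lambda=(q_{i,j})_{1\le i,j\le\nu}$ be nonzero elements of $k$ with $q_{i,i}=1$ and $q_{i,j}q_{j,i}=1$ for all $i<j$. Assume that $\Lambda$ generates a free abelian group of rank $\nu(\nu-1)/2$ in $k^\times$. Let $S(X_\nu,\Lambda)$ be the multiparametric affine space, i.e. the unital associative $k$-algebra generated by $x_1,\dots,x_\nu$ subject to the relations $x_jx_i=q_{i,j}x_ix_j$ for $1\le i,j\le\nu$. Then $$HH_n(S(X_\nu,\Lambda))\cong\begin{cases} k\oplus\bigoplus_{i=1}^{\nu} x_ik[x_i] & \text{if } n=0,\\ \bigoplus_{i=1}^{\nu} k[x_i]\otimes x_i & \text{if } n=1,\\ 0 & \text{if } n\ge 2.\end{cases}$$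
   Context: $HH_n(C)=H_n(C,C)$ denotes the Hochschild homology over $k$ of a unital associative $k$-algebra $C$ with coefficients in itself. The notation $k[x_i]\otimes x_i$ stands for the space spanned by the tensors $x_i^m\otimes x_i$, $m\ge 0$, a copy of the vector space $k[x_i]$. *)

(* Defs.v *)
From HB Require Import structures.
From mathcomp Require Import all_boot all_algebra finmap zify.
From mathcomp Require Import boolp.
From mathcomp.multinomials Require Import monalg.

Set Implicit Arguments.
Unset Strict Implicit.
Unset Printing Implicit Defensive.

Import GRing.Theory.

Local Open Scope ring_scope.
Local Open Scope quotient_scope.

Module RawQuotient.
Section QuotientModule.
Variables (k : fieldType) (V : lmodType k) (W : submodClosed V).

(* submodClosed does not inherit from the zmodClosed that Quotient.quot needs. *)
Definition sub_zmod : {pred V} := fun x => x \in W.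

Lemma sub_zmod_closed : zmod_closed sub_zmod.
Proof. exact: GRing.submod_closedB (GRing.submodClosedP W). Qed.

HB.instance Definition _ := GRing.isZmodClosed.Build V sub_zmod sub_zmod_closed.

(* The quotient vector space V / W: the quotient Z-module, to which a scaling
   operation is added. *)
Definition qmod : Type := Quotient.quot sub_zmod.
Local Notation Q := qmod.

HB.instance Definition _ := GRing.Zmodule.on Q.
HB.instance Definition _ := Quotient.on Q.

Definition qpi (x : V) : Q := \pi_Q x.

Lemma qpi_repr (x : Q) : qpi (repr x) = x.
Proof. exact: reprK. Qed.

Lemma qpi_eq (x y : V) : (qpi x == qpi y) = (x - y \in W).
Proof. exact: esym (Quotient.idealrBE sub_zmod x y). Qed.

Lemma qpi_zmod_morphism : zmod_morphism qpi.
Proof. exact: (raddfB (\pi_(Quotient.quot sub_zmod))). Qed.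

HB.instance Definition _ := GRing.isZmodMorphism.Build V Q qpi qpi_zmod_morphism.

Definition qscale (a : k) (x : Q) : Q := qpi (a *: repr x).

Lemma qscale_pi a x : qscale a (qpi x) = qpi (a *: x).
Proof. by apply/eqP; rewrite qpi_eq -scalerBr rpredZ // -qpi_eq qpi_repr. Qed.

Lemma qscaleA a b x : qscale a (qscale b x) = qscale (a * b) x.
Proof. by rewrite -[x]qpi_repr !qscale_pi scalerA. Qed.

Lemma qscale1 : left_id 1 qscale.
Proof. by move=> x; rewrite -[x]qpi_repr qscale_pi scale1r. Qed.

Lemma qscaleDr : right_distributive qscale +%R.
Proof.
move=> a x y; rewrite -[x]qpi_repr -[y]qpi_repr -raddfD !qscale_pi.
by rewrite scalerDr raddfD.
Qed.

Lemma qscaleDl x : {morph qscale^~ x : a b / a + b}.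
Proof. by move=> a b; rewrite -[x]qpi_repr !qscale_pi scalerDl raddfD. Qed.

HB.instance Definition _ :=
  GRing.Zmodule_isLmodule.Build k Q qscaleA qscale1 qscaleDr qscaleDl.

Lemma qpi_scalable : scalable qpi.
Proof. by move=> a x; rewrite -qscale_pi. Qed.

HB.instance Definition _ := GRing.isScalable.Build k V Q *:%R qpi qpi_scalable.

Definition pack : {U : lmodType k & {linear V -> U}} :=
  existT (fun U : lmodType k => {linear V -> U}) (Q : lmodType k)
         (qpi : {linear V -> Q}).

End QuotientModule.
End RawQuotient.

(* The quotient space V / W together with the projection from V. It is locked,
   since unification is slow when it can unfold the quotient. *)
HB.lock Definition quotient_space (k : fieldType) (V : lmodType k)
    (W : submodClosed V) : {Q : lmodType k & {linear V -> Q}} :=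
  RawQuotient.pack W.

Section QuotientModule.
Variables (k : fieldType) (V : lmodType k) (W : submodClosed V).

Definition qmod : lmodType k := projT1 (quotient_space.body W).
Definition qpi : {linear V -> qmod} := projT2 (quotient_space.body W).

Lemma qpi_eq (x y : V) : (qpi x == qpi y) = (x - y \in W).
Proof.
rewrite /qpi /qmod quotient_space.unlock; exact: RawQuotient.qpi_eq.
Qed.

Lemma qpi_surj (x : qmod) : exists y, qpi y = x.
Proof.
rewrite /qpi /qmod quotient_space.unlock in x *.
by exists (repr x); exact: RawQuotient.qpi_repr.
Qed.

Definition qrepr (x : qmod) : V := sval (cid (qpi_surj x)).

Lemma qpi_repr (x : qmod) : qpi (qrepr x) = x.
Proof. exact: svalP (cid (qpi_surj x)). Qed.

End QuotientModule.

Section Span.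
Variables (k : fieldType) (V : lmodType k) (S : V -> Prop).

Inductive span : V -> Prop :=
| span_in x : S x -> span x
| span_0 : span 0
| span_lin a x y : span x -> span y -> span (a *: x + y).

Definition span_pred : {pred V} := fun x => `[< span x >].

Lemma span_predP x : reflect (span x) (x \in span_pred).
Proof. exact: asboolP. Qed.

Lemma span_submod_closed : submod_closed span_pred.
Proof.
split; first by apply/span_predP; exact: span_0.
move=> a x y /span_predP hx /span_predP hy; apply/span_predP; exact: span_lin.
Qed.

HB.instance Definition _ :=
  GRing.isSubmodClosed.Build k V span_pred span_submod_closed.

End Span.

(* The linear map {malg k[K]} -> V extending f on the basis K. *)
Section LinearExtension.
Variables (k : fieldType) (K : choiceType) (V : lmodType k) (f : K -> V).

Definition lext (g : {malg k[K]}) : V := \sum_(m <- msupp g) g@_m *: f m.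

Lemma lextEw (d : {fset K}) (g : {malg k[K]}) :
  (msupp g `<=` d)%fset -> lext g = \sum_(m <- d) g@_m *: f m.
Proof.
move=> le_gd; rewrite /lext (big_fset_incl _ le_gd) // => m _ /mcoeff_outdom->.
by rewrite scale0r.
Qed.

Lemma lext_linear : linear lext.
Proof.
move=> a g h.
pose d := (msupp (a *: g + h) `|` msupp g `|` msupp h)%fset.
rewrite !(@lextEw d) ?scaler_sumr -?big_split /=; first last.
- by rewrite /d -fsetUA fsubsetUl.
- by rewrite /d fsetUAC fsubsetUr.
- by rewrite /d fsubsetUr.
by apply: eq_bigr => m _; rewrite mcoeffD mcoeffZ scalerDl scalerA.
Qed.

HB.instance Definition _ :=
  GRing.isLinear.Build k {malg k[K]} V *:%R lext lext_linear.

Lemma lextU (m : K) : lext << m >> = f m.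
Proof.
by rewrite (lextEw (@msuppU_le _ _ _ _)) big_seq_fset1 mcoeffUU scale1r.
Qed.

End LinearExtension.

Section TensorPower.
Variables (k : fieldType) (A : lmodType k) (m : nat).

Definition upd (a : {ffun 'I_m -> A}) (i : 'I_m) (x : A) : {ffun 'I_m -> A} :=
  [ffun j => if j == i then x else a j].

Definition tensor_rel (z : {malg k[{ffun 'I_m -> A}]}) : Prop :=
  exists a i c x y,
    z = << upd a i (c *: x + y) >> - (c *: << upd a i x >> + << upd a i y >>).

(* The m-th tensor power of A over k: the vector space with basis the
   m-tuples of elements of A, modulo multilinearity. *)
Definition tpow : lmodType k := qmod (span_pred tensor_rel).

Definition tpi : {linear {malg k[{ffun 'I_m -> A}]} -> tpow} := qpi _.

Definition tensor (a : {ffun 'I_m -> A}) : tpow := tpi << a >>.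

Lemma tensor_span (z : tpow) :
  exists g : {malg k[{ffun 'I_m -> A}]},
    z = \sum_(a <- msupp g) g@_a *: tensor a.
Proof.
exists (qrepr z); rewrite -[LHS]qpi_repr {1}[qrepr z]monalgE.
rewrite [LHS](linear_sum tpi); apply: eq_bigr => a _.
rewrite -[RHS](linearZ_LR tpi); congr (tpi _).
by apply/malgP => b; rewrite mcoeffZ !mcoeffU mulr_natr.
Qed.

Definition multilinear (V : lmodType k) (f : {ffun 'I_m -> A} -> V) : Prop :=
  forall a i c x y, f (upd a i (c *: x + y)) = c *: f (upd a i x) + f (upd a i y).

Lemma tensor_multilinear : multilinear tensor.
Proof.
move=> a i c x y; rewrite /tensor -linearP.
by apply/eqP; rewrite qpi_eq; apply/span_predP/span_in; exists a, i, c, x, y.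
Qed.

(* The linear map on tpow induced by f; meaningful when f is multilinear. *)
Definition tlift (V : lmodType k) (f : {ffun 'I_m -> A} -> V) (z : tpow) : V :=
  lext f (qrepr z).

Section Lift.
Variables (V : lmodType k) (f : {ffun 'I_m -> A} -> V) (fL : multilinear f).

Lemma tlift_pi z : tlift f (tpi z) = lext f z.
Proof.
apply/eqP; rewrite -subr_eq0 -linearB /=.
have : qrepr (tpi z) - z \in span_pred tensor_rel.
  by rewrite -qpi_eq qpi_repr.
move=> /span_predP; elim=> [x | | a x y _ /eqP hx _ /eqP hy].
- case=> a [i [c [x1 [y ->]]]].
  by rewrite linearB linearD linearZ /= !lextU fL subrr.
- by rewrite linear0.
- by rewrite linearP /= hx hy scaler0 addr0.
Qed.

Lemma tlift_tensor a : tlift f (tensor a) = f a.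
Proof. by rewrite tlift_pi lextU. Qed.

Lemma tlift_linear : linear (tlift f).
Proof.
move=> a x y; rewrite -[x]qpi_repr -[y]qpi_repr -linearP !tlift_pi.
exact: lext_linear.
Qed.

End Lift.
End TensorPower.

(* The space of Hochschild n-chains of A with coefficients in A. *)
Notation hchain A n := (tpow A n.+1).

Section Hochschild.
Variables (k : fieldType) (A : algType k).

(* For a = (a_0, ..., a_{n+1}), hface a i is
     (a_0, ..., a_i a_{i+1}, ..., a_{n+1})   if i <= n,
     (a_{n+1} a_0, a_1, ..., a_n)            if i = n + 1. *)
Definition hface n (a : {ffun 'I_n.+2 -> A}) (i : 'I_n.+2) :
    {ffun 'I_n.+1 -> A} :=
  [ffun j : 'I_n.+1 =>
    let a_j := a (widen_ord (leqnSn _) j) in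
    let a_j1 := a (lift ord0 j) in
    if i == ord_max then (if j == ord0 then a ord_max * a_j else a_j)
    else if (j < i)%N then a_j
    else if j == i :> nat then a_j * a_j1
    else a_j1].

Definition hdiff n (a : {ffun 'I_n.+2 -> A}) : hchain A n :=
  \sum_(i < n.+2) (-1) ^+ i *: tensor (hface a i).

(* The Hochschild differential b from degree n + 1 to degree n. *)
Definition hbdry n : hchain A n.+1 -> hchain A n := tlift (@hdiff n).

Lemma hface_upd n (a : {ffun 'I_n.+2 -> A}) (i p : 'I_n.+2) :
  exists j l r, forall z, hface (upd a p z) i = upd (hface a i) j (l * z * r).
Proof.
pose s : 'I_n.+1 := inord (if i == ord_max then (if p == ord_max then 0 else val p)
                           else if (p <= i)%N then val p else p.-1).
have s_val : s = (if i == ord_max then (if p == ord_max then 0 else val p)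
                  else if (p <= i)%N then val p else p.-1)%N :> nat.
  rewrite inordK //; move: (ltn_ord p) (ltn_ord i); rewrite -!val_eqE /=.
  by case: ifP => hi; case: ifP => hp; lia.
pose l := if i == ord_max then (if p == ord0 then a ord_max else 1)
          else if p == i.+1 :> nat then a (widen_ord (leqnSn _) s) else 1.
pose r := if i == ord_max then (if p == ord_max then a ord0 else 1)
          else if p == i then a (lift ord0 s) else 1.
exists s, l, r => z; apply/ffunP => j; rewrite !ffunE /l /r {l r}.
move: s s_val => s s_val.
have [-> | /eqP neq_js] := eqVneq j s.
- have s0 : s = 0%N :> nat -> widen_ord (leqnSn n.+1) s = ord0.
    by move=> s0; apply: val_inj.
  move: s_val (ltn_ord p) (ltn_ord i); rewrite -!val_eqE /= /bump /= add1n.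
  move=> + lt_p lt_i.
  repeat (case: ifP => ?; try by move=> ?; exfalso; lia); move=> s_val;
    rewrite ?mulr1 ?mul1r //; by rewrite s0.
- have {}neq_js : j <> s :> nat by move=> /val_inj.
  move: s_val (ltn_ord p) (ltn_ord i) (ltn_ord j).
  rewrite -!val_eqE /= /bump /= !add1n => + lt_p lt_i lt_j.
  by repeat (case: ifP => ?; try by move=> ?; exfalso; lia).
Qed.

Lemma hface_multilinear n (i : 'I_n.+2) :
  multilinear (fun a => tensor (hface a i) : hchain A n).
Proof.
move=> a p c x y; have [j [l [r eq_ap]]] := hface_upd a i p.
rewrite !eq_ap mulrDr mulrDl -scalerAr -scalerAl.
exact: tensor_multilinear.
Qed.

Lemma hdiff_multilinear n : multilinear (@hdiff n).
Proof.
move=> a i c x y; rewrite /hdiff scaler_sumr -big_split /=; apply: eq_bigr => j _.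
by rewrite hface_multilinear scalerDr !scalerA mulrC.
Qed.

Lemma hbdry_tensor n (a : {ffun 'I_n.+2 -> A}) :
  hbdry (tensor a) = \sum_(i < n.+2) (-1) ^+ i *: tensor (hface a i).
Proof. exact: (tlift_tensor (@hdiff_multilinear n)). Qed.

Lemma hbdry_linear n : linear (@hbdry n).
Proof. exact: tlift_linear (@hdiff_multilinear n). Qed.

HB.instance Definition _ n :=
  GRing.isLinear.Build k (hchain A n.+1) (hchain A n) *:%R (@hbdry n)
    (@hbdry_linear n).

Lemma hface_hface n (a : {ffun 'I_n.+3 -> A}) (j : 'I_n.+3) (i : 'I_n.+2) :
  (i < j)%N ->
  hface (hface a j) i = hface (hface a (widen_ord (leqnSn _) i)) (inord j.-1).
Proof.
pose fN N (g : nat -> A) (i l : nat) :=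
  if i == N.+1 then (if l == 0%N then g N.+1 * g l else g l)
  else if (l < i)%N then g l else if l == i then g l * g l.+1 else g l.+1.
have fNE N (b : {ffun 'I_N.+2 -> A}) g p l : (forall q, b q = g (val q)) ->
    hface b p l = fN N g (val p) (val l).
  by move=> bE; rewrite ffunE !bE -!val_eqE /= /bump /= add1n.
move=> lt_ij; apply/ffunP => l.
pose g m := a (inord m).
have ffE p q l' : hface (hface a p) q l' = fN n (fN n.+1 g (val p)) (val q) (val l').
  by apply: (fNE) => r; apply: (fNE) => r'; rewrite /g inord_val.
rewrite !ffE.
have jE : val (inord j.-1 : 'I_n.+2) = j.-1 :> nat.
  by rewrite /= inordK //; move: (ltn_ord j); lia.
rewrite jE {jE}; move: (ltn_ord l) (ltn_ord i) (ltn_ord j) lt_ij; rewrite /fN /=.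
move: (val l) (val i) (val j) => /= {}l {}i {}j lt_l lt_i lt_j lt_ij.
repeat (case: ifP => ?; try by exfalso; lia); rewrite ?mulrA //;
  try by (congr (_ * _); congr g; lia).
all: try (by congr (g _); lia).
Qed.

Lemma hbdry_hbdry_tensor n (a : {ffun 'I_n.+3 -> A}) :
  hbdry (hbdry (tensor a : hchain A n.+2)) = 0.
Proof.
rewrite hbdry_tensor (linear_sum (@hbdry n)).
under eq_bigr => j _ do
  rewrite (linearZ_LR (@hbdry n)) /= hbdry_tensor scaler_sumr.
rewrite pair_bigA /= (bigID (fun p : 'I_n.+3 * 'I_n.+2 => p.2 < p.1)%N) /=.
pose h (p : 'I_n.+3 * 'I_n.+2) : 'I_n.+3 * 'I_n.+2 :=
  (widen_ord (leqnSn _) p.2, inord p.1.-1).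
pose h' (p : 'I_n.+3 * 'I_n.+2) : 'I_n.+3 * 'I_n.+2 :=
  (lift ord0 p.2, inord p.1).
rewrite [X in _ + X](reindex_onto h h') /=; last first.
  move=> [j i] /= le_ji; congr pair; apply: val_inj;
  by rewrite /= inordK //; move: (ltn_ord i); lia.
rewrite [X in _ + X](eq_bigl
  (fun p : 'I_n.+3 * 'I_n.+2 => (p.2 < p.1)%N)); last first.
  move=> [j i] /=; rewrite -pair_eqE /pair_eq /= -!val_eqE /= /bump /= add1n.
  move: (ltn_ord i) (ltn_ord j) => lt_i lt_j.
  by rewrite !inordK; lia.
rewrite -big_split big1 // => -[j i] /= lt_ij.
rewrite (hface_hface a lt_ij) !scalerA -!exprD -scalerDl.
rewrite inordK; last by move: (ltn_ord j); lia.
have -> : (j + i = (i + j.-1).+1)%N by lia.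
by rewrite exprS mulN1r addNr scale0r.
Qed.

Lemma hbdry_hbdry n (z : hchain A n.+2) : hbdry (hbdry z) = 0.
Proof.
have [g ->] := tensor_span z.
rewrite (linear_sum (@hbdry n.+1)) (linear_sum (@hbdry n)).
rewrite big1 // => a _.
rewrite (linearZ_LR (@hbdry n.+1)) (linearZ_LR (@hbdry n)) /=.
by rewrite hbdry_hbdry_tensor scaler0.
Qed.

(* Every 0-chain is a cycle. *)
Definition hcycle_pred n : {pred hchain A n} :=
  match n with
  | 0 => fun=> true
  | m.+1 => fun z => hbdry z == 0
  end.

Lemma hcycle_submod_closed n : submod_closed (@hcycle_pred n).
Proof.
case: n => [|n]; first by split.
split; first by rewrite unfold_in /= (linear0 (@hbdry n)).
move=> a x y; rewrite !unfold_in => /eqP hx /eqP hy.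
by rewrite hbdry_linear hx hy scaler0 addr0.
Qed.

HB.instance Definition _ n :=
  GRing.isSubmodClosed.Build k (hchain A n) (@hcycle_pred n)
    (@hcycle_submod_closed n).

Record hcycle n := HCycle {
  hcycle_val : hchain A n;
  _ : hcycle_val \in @hcycle_pred n }.

HB.instance Definition _ n := [isSub for @hcycle_val n].
HB.instance Definition _ n := [Choice of hcycle n by <:].
HB.instance Definition _ n := [SubChoice_isSubLmodule of hcycle n by <:].

Definition hbound_pred n : {pred hcycle n} :=
  fun z => `[< exists y : hchain A n.+1, val z = hbdry y >].

Lemma hbound_submod_closed n : submod_closed (@hbound_pred n).
Proof.
split; first by apply/asboolP; exists 0; rewrite (linear0 (@hbdry n)).
move=> a x y /asboolP [x' hx] /asboolP [y' hy]; apply/asboolP.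
by exists (a *: x' + y'); rewrite hbdry_linear -hx -hy; exact: linearP.
Qed.

HB.instance Definition _ n :=
  GRing.isSubmodClosed.Build k (hcycle n) (@hbound_pred n)
    (@hbound_submod_closed n).

Definition HH n : lmodType k := qmod (@hbound_pred n).

Definition hclass n : {linear hcycle n -> HH n} := qpi _.

End Hochschild.

Section AlgebraQuotient.
Variables (k : fieldType) (F : algType k) (R : F -> Prop).

(* The two-sided ideal generated by R is the span of the products a * r * b. *)
Definition ideal_rel (z : F) : Prop := exists a r b, R r /\ z = a * r * b.

Definition ideal_pred : {pred F} := span_pred ideal_rel.
HB.instance Definition _ := GRing.SubmodClosed.on ideal_pred.

Lemma ideal_predM (a x b : F) : x \in ideal_pred -> a * x * b \in ideal_pred.
Proof.
move=> /span_predP hx; apply/span_predP; elim: hx => [z | | c y z _ hy _ hz].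
- case=> [a' [r [b' [hr ->]]]]; apply: span_in; exists (a * a'), r, (b' * b).
  by rewrite !mulrA.
- by rewrite mulr0 mul0r; exact: span_0.
- by rewrite mulrDr mulrDl -scalerAr -scalerAl; exact: span_lin.
Qed.

Section Character.
Variable e : F -> k.
Hypothesis eL : forall c x y, e (c *: x + y) = c * e x + e y.
Hypothesis eM : forall x y, e (x * y) = e x * e y.
Hypothesis e1 : e 1 = 1.

Lemma char_comm c x y : e x = 0 -> e y = 0 -> e (y * x - c *: (x * y)) = 0.
Proof. by move=> x0 y0; rewrite addrC -scaleNr eL !eM x0 y0 !mulr0 addr0. Qed.

Lemma ideal_proper : (forall r, R r -> e r = 0) -> 1 \notin ideal_pred.
Proof.
move=> eR; have I0 x : x \in ideal_pred -> e x = 0.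
  move=> /span_predP; elim=> [z | | c y z _ hy _ hz].
  - by case=> [a [r [b [hr ->]]]]; rewrite !eM (eR _ hr) mulr0 mul0r.
  - by have := eL (-1) 0 0; rewrite scaler0 add0r mulN1r addNr.
  - by rewrite eL hy hz mulr0 addr0.
by apply/negP => /I0 /eqP; rewrite e1 oner_eq0.
Qed.

End Character.

(* Properness is required because an nzRingType is nontrivial. *)
Definition qalg (_ : 1 \notin ideal_pred) : Type := qmod ideal_pred.

Hypothesis proper : 1 \notin ideal_pred.
Local Notation Q := (qalg proper).
HB.instance Definition _ := GRing.Lmodule.on Q.

Definition qapi : F -> Q := qpi _.
HB.instance Definition _ := GRing.Linear.on qapi.

Lemma qapi_repr (x : Q) : qapi (qrepr x) = x.
Proof. exact: qpi_repr. Qed.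

Lemma qapiZ c x : qapi (c *: x) = c *: qapi x.
Proof. exact: linearZ_LR. Qed.

Lemma qapi_eq x y : (qapi x == qapi y) = (x - y \in ideal_pred).
Proof. exact: qpi_eq. Qed.

Definition qa_one : Q := qapi 1.
Definition qa_mul (x y : Q) : Q := qapi (qrepr x * qrepr y).

Lemma qa_mul_pi x y : qa_mul (qapi x) (qapi y) = qapi (x * y).
Proof.
have ker z : qrepr (qapi z) - z \in ideal_pred by rewrite -qapi_eq qapi_repr.
apply/eqP; rewrite qapi_eq.
have -> : qrepr (qapi x) * qrepr (qapi y) - x * y =
    1 * (qrepr (qapi x) - x) * qrepr (qapi y) + x * (qrepr (qapi y) - y) * 1.
  by rewrite mul1r mulr1 mulrBl mulrBr addrA subrK.
by rewrite rpredD // ideal_predM.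
Qed.

Lemma qa_mulA : associative qa_mul.
Proof.
move=> x y z; rewrite -[x]qapi_repr -[y]qapi_repr -[z]qapi_repr.
by rewrite !qa_mul_pi mulrA.
Qed.

Lemma qa_mul1x : left_id qa_one qa_mul.
Proof. by move=> x; rewrite -[x]qapi_repr qa_mul_pi mul1r. Qed.

Lemma qa_mulx1 : right_id qa_one qa_mul.
Proof. by move=> x; rewrite -[x]qapi_repr qa_mul_pi mulr1. Qed.

Lemma qa_mulDl : left_distributive qa_mul +%R.
Proof.
move=> x y z; rewrite -[x]qapi_repr -[y]qapi_repr -[z]qapi_repr -raddfD.
by rewrite !qa_mul_pi mulrDl raddfD.
Qed.

Lemma qa_mulDr : right_distributive qa_mul +%R.
Proof.
move=> x y z; rewrite -[x]qapi_repr -[y]qapi_repr -[z]qapi_repr -raddfD.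
by rewrite !qa_mul_pi mulrDr raddfD.
Qed.

Lemma qa_one_neq0 : qa_one != 0.
Proof. by rewrite -[X in _ != X](raddf0 qapi) qapi_eq subr0. Qed.

HB.instance Definition _ := GRing.Zmodule_isNzRing.Build Q
  qa_mulA qa_mul1x qa_mulx1 qa_mulDl qa_mulDr qa_one_neq0.

Lemma qapi_monoid_morphism : monoid_morphism qapi.
Proof. by split=> // x y; rewrite -qa_mul_pi. Qed.

Lemma qapiM x y : qapi (x * y) = qapi x * qapi y.
Proof. exact: qapi_monoid_morphism.2. Qed.

HB.instance Definition _ :=
  GRing.isMonoidMorphism.Build F Q qapi qapi_monoid_morphism.

Lemma qa_scaleAl (c : k) (x y : Q) : c *: (x * y) = c *: x * y.
Proof.
rewrite -[x]qapi_repr -[y]qapi_repr -(qapiZ c (qrepr x)) -!qapiM -qapiZ.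
by rewrite scalerAl.
Qed.

HB.instance Definition _ := GRing.Lmodule_isLalgebra.Build k Q qa_scaleAl.

Lemma qa_scaleAr (c : k) (x y : Q) : c *: (x * y) = x * (c *: y).
Proof.
rewrite -[x]qapi_repr -[y]qapi_repr -(qapiZ c (qrepr y)) -!qapiM -qapiZ.
by rewrite scalerAr.
Qed.

HB.instance Definition _ := GRing.Lalgebra_isAlgebra.Build k Q qa_scaleAr.

End AlgebraQuotient.

Section FreeAlgebra.
Variables (k : fieldType) (nu : nat).

(* The free unital associative algebra on nu generators: the monoid algebra of
   the words in 'I_nu. *)
Definition freealg : Type := {malg k[{fmonom 'I_nu}]}.
HB.instance Definition _ := GRing.Lalgebra.on freealg.

Lemma freealg_scaleAr (c : k) (x y : freealg) : c *: (x * y) = x * (c *: y).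
Proof.
have comC (g : freealg) : g * c%:MP = c%:MP * g.
  rewrite [LHS]malgM_def fgmulgU [RHS]malgM_def fgmulUg; apply: eq_bigr => m _.
  by rewrite mulm1 mul1m mulrC.
by rewrite -!mul_malgC !mulrA comC.
Qed.

HB.instance Definition _ :=
  GRing.Lalgebra_isAlgebra.Build k freealg freealg_scaleAr.

Definition freegen (i : 'I_nu) : freealg := << fmu i >>.

(* The augmentation, i.e. the constant coefficient. *)
Definition aug : freealg -> k := @mcoeff {fmonom 'I_nu} k mone.

Lemma aug_linear c x y : aug (c *: x + y) = c * aug x + aug y.
Proof. by rewrite /aug mcoeffD mcoeffZ. Qed.

Lemma augM x y : aug (x * y) = aug x * aug y.
Proof. exact: (rmorphM (@mcoeff {fmonom 'I_nu} k mone)). Qed.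

Lemma aug1 : aug 1 = 1.
Proof. exact: (rmorph1 (@mcoeff {fmonom 'I_nu} k mone)). Qed.

Lemma aug_gen i : aug (freegen i) = 0.
Proof. by rewrite /aug mcoeffU1 fmP fm1 fmU. Qed.

End FreeAlgebra.

Section AffineSpace.
Variables (k : fieldType) (nu : nat) (Lambda : 'M[k]_nu).

(* The relations x_j x_i = q_{i,j} x_i x_j. *)
Definition aff_rel (z : freealg k nu) : Prop :=
  exists i j : 'I_nu, z = freegen k j * freegen k i -
                          Lambda i j *: (freegen k i * freegen k j).

Lemma aff_proper : 1 \notin ideal_pred aff_rel.
Proof.
apply: (ideal_proper (@aug_linear k nu) (@augM k nu) (aug1 k nu)) => _ [i [j ->]].
exact: (char_comm (@aug_linear k nu) (@augM k nu)) (aug_gen k i) (aug_gen k j).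
Qed.

(* S(X_nu, Lambda), with generators aff_gen i. *)
Definition affine_space : Type := qalg aff_proper.
HB.instance Definition _ := GRing.Algebra.on affine_space.

Definition aff_gen (i : 'I_nu) : affine_space := qapi aff_proper (freegen k i).

Lemma aff_gen_rel i j :
  aff_gen j * aff_gen i = Lambda i j *: (aff_gen i * aff_gen j).
Proof.
rewrite /aff_gen -!qapiM -qapiZ; apply/eqP; rewrite qapi_eq.
apply/span_predP/span_in.
exists 1, (freegen k j * freegen k i - Lambda i j *: (freegen k i * freegen k j)), 1.
by split; [exists i, j | rewrite mul1r mulr1].
Qed.

End AffineSpace.

Section MultiplicativeGroup.
Variable k : fieldType.

(* The subgroup of k^* generated by a set S of nonzero elements. *)
Inductive mulgen (S : k -> Prop) : k -> Prop :=
| mulgen_in x : S x -> mulgen S x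
| mulgen_1 : mulgen S 1
| mulgen_M x y : mulgen S x -> mulgen S y -> mulgen S (x * y)
| mulgen_V x : mulgen S x -> mulgen S x^-1.

(* The subgroup G of k^* is isomorphic to the additive group int^r. *)
Definition free_abelian_of_rank (G : k -> Prop) (r : nat) : Prop :=
  exists f : 'rV[int]_r -> k,
    [/\ f 0 = 1, forall u v, f (u + v) = f u * f v, injective f &
        forall y, G y <-> exists u, f u = y].

End MultiplicativeGroup.

Section XPoly.
Variable k : fieldType.

Definition xpoly_pred : {pred {poly k}} := fun p => 'X %| p.

Lemma xpoly_submod_closed : submod_closed xpoly_pred.
Proof.
split; first exact: dvdp0.
by move=> c p q hp hq; apply: dvdp_add => //; rewrite -mul_polyC dvdp_mull.
Qed.

HB.instance Definition _ :=
  GRing.isSubmodClosed.Build k {poly k} xpoly_pred xpoly_submod_closed.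

(* The vector space x k[x]. *)
Record xpoly := XPoly {
  xpoly_val :> {poly k};
  _ : xpoly_val \in xpoly_pred }.

HB.instance Definition _ := [isSub for xpoly_val].
HB.instance Definition _ := [Choice of xpoly by <:].
HB.instance Definition _ := [SubChoice_isSubLmodule of xpoly by <:].

End XPoly.

Section Chains.
Variables (k : fieldType) (A : algType k).

Definition chain0 (a : A) : hchain A 0 := tensor [ffun=> a].

Definition chain1 (a b : A) : hchain A 1 :=
  tensor [ffun j : 'I_2 => if j == ord0 then a else b].

(* HH_n(A) is isomorphic to V by the linear map that sends u to the homology
   class of the chain t u, which must be a cycle. *)
Definition HH_iso_by n (V : lmodType k) (t : V -> hchain A n) : Prop :=
  exists2 f : {linear V -> HH A n}, bijective f &
    forall u, exists2 z : hcycle A n, val z = t u & f u = hclass A n z.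

End Chains.

(* Main.v *)
Require Import Defs.
From HB Require Import structures.
From mathcomp Require Import all_boot all_algebra finmap zify ring.
From mathcomp Require Import boolp.
From mathcomp.multinomials Require Import monalg.

Set Implicit Arguments.
Unset Strict Implicit.
Unset Printing Implicit Defensive.

Import GRing.Theory.
Local Open Scope ring_scope.

(** The ordered monomials x^a, for a in the monoid N^nu of degrees, form a basis
of S, and x^a x^b = c(a,b) x^(a+b) with c bimultiplicative. The total degree
grades the Hochschild complex by N^nu.

Fix a degree d, and divide the tensor of x^(a_0), ..., x^(a_n) by the scalar
that relates the product x^(a_0) ... x^(a_n) to x^d. All faces but the last
then merge two neighbours with coefficient 1, and the last, cyclic face gets the
coefficient psi(a_n), where psi(a) = c(a,d) / c(d,a) is a character of N^nu.
As a_0 is determined by d, the degree d part is the complex T(psi,d) spanned by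
the words (a_1, ..., a_n) of sum at most d. This complex makes sense for every
multiplicative map psi from N^nu to k, and the value 0 on a generator is
allowed: that freedom is the point of the proof. Write e_i for the generators.

If psi and psi' differ only at e_i, their differentials agree on T(psi,d+e_i)
modulo words of sum at most d. So when T(psi',d) and T(psi',d+e_i) are acyclic,
every cycle of T(psi,d+e_i) is homologous to one of T(psi,d)
([acyclic_switch]). When psi vanishes on all e_j and d is not 0, putting
d minus the sum in front of a word contracts T(psi,d). Restoring the values of
psi at the other generators one by one gives [acyclic_vanishing]: T(psi,d) is
acyclic when psi(e_i) = 0 and d_i > 0. If only psi(e_i) <> 1 is known, the
switch lemma reduces to d_i = 1; there the differential is the combination
(1 - psi(e_i)) D_0 + psi(e_i) D_1 of those with value 0 and 1 at e_i, and erasing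
all i-th coordinates is a chain map for D_1, which gives [acyclic_unit] and then
[acyclic_neq1].

Independence of the parameters gives psi(e_i) <> 1 whenever d_i > 0 and d has
another nonzero coordinate ([psi_neq1]). Only the degrees d = m e_i remain;
there psi(e_i) = 1, and every cycle is, up to a boundary, a combination of the
empty word and of the word (e_i) ([one_variable]), that is of x_i^m and of
x_i^(m-1) (x) x_i. These classes are linearly independent: the algebra map eps_i
from S to k[X] that kills x_j for j <> i makes a |-> eps_i(a) and
a (x) b |-> eps_i(a) eps_i(b)' vanish on boundaries. *)

(** * Free modules *)

(** The free module is reached through an opaque existence proof: unification
would otherwise unfold monoid algebras. *)
Record freemod (k : fieldType) (K : choiceType) := FreeMod {
  fmod_of : lmodType k;
  fb_of : K -> fmod_of;
  fcoef_of : K -> fmod_of -> k;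
  fsupp_of : fmod_of -> seq K;
  fext_of : forall V : lmodType k, (K -> V) -> {linear fmod_of -> V};
  fcoef_of_linear : forall w c x y,
    fcoef_of w (c *: x + y) = c * fcoef_of w x + fcoef_of w y;
  fcoef_of_fb : forall w v, fcoef_of w (fb_of v) = (v == w)%:R;
  fext_ofE : forall V f w, @fext_of V f (fb_of w) = f w;
  fmod_ofE : forall g, g = \sum_(w <- fsupp_of g) fcoef_of w g *: fb_of w }.

Lemma freemod_exists (k : fieldType) (K : choiceType) : freemod k K.
Proof.
exists {malg k[K]} (fun w => << w >>) (fun w g => g@_w)
  (fun g => msupp g) (fun V f => lext f).
- by move=> w c x y; rewrite mcoeffD mcoeffZ.
- by move=> w v; rewrite mcoeffU.
- by move=> V f w; exact: lextU.
move=> g; rewrite {1}[g]monalgE; apply: eq_bigr => w _.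
by apply/malgP => v; rewrite mcoeffZ !mcoeffU mulr_natr.
Qed.

Section FreeModule.
Variables (k : fieldType) (K : choiceType).

Definition fmod : lmodType k := fmod_of (freemod_exists k K).
Definition fb (w : K) : fmod := fb_of _ w.
Definition fcoef (w : K) (g : fmod) : k := fcoef_of w g.
Definition fsupp (g : fmod) : seq K := fsupp_of g.
Definition fext (V : lmodType k) (f : K -> V) : {linear fmod -> V} := fext_of _ f.

Lemma fextE (V : lmodType k) (f : K -> V) w : fext f (fb w) = f w.
Proof. exact: fext_ofE. Qed.

Lemma fcoef_linear w c x y : fcoef w (c *: x + y) = c * fcoef w x + fcoef w y.
Proof. exact: fcoef_of_linear. Qed.

Lemma fcoef0 w : fcoef w 0 = 0.
Proof. by have := fcoef_linear w (-1) 0 0; rewrite scaler0 addr0 mulN1r addNr. Qed.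

Lemma fcoef_fb w v : fcoef w (fb v) = (v == w)%:R.
Proof. exact: fcoef_of_fb. Qed.

Lemma fmodE (g : fmod) : g = \sum_(w <- fsupp g) fcoef w g *: fb w.
Proof. exact: fmod_ofE. Qed.

Definition supp_in (X : pred K) : {pred fmod} :=
  fun g => `[< forall w, fcoef w g != 0 -> X w >].

Lemma supp_inP (X : pred K) (g : fmod) :
  reflect (forall w, fcoef w g != 0 -> X w) (g \in supp_in X).
Proof. exact: asboolP. Qed.

Lemma supp_in_submod_closed X : submod_closed (supp_in X).
Proof.
split; first by apply/supp_inP => w; rewrite fcoef0 eqxx.
move=> a g h /supp_inP gX /supp_inP hX; apply/supp_inP => w.
rewrite fcoef_linear; have [g0|/gX //] := eqVneq (fcoef w g) 0.
by rewrite g0 mulr0 add0r => /hX.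
Qed.

HB.instance Definition _ X :=
  GRing.isSubmodClosed.Build k fmod (supp_in X) (supp_in_submod_closed X).

Lemma supp_in_basis (X : pred K) w : X w -> fb w \in supp_in X.
Proof.
move=> Xw; apply/supp_inP => v; rewrite fcoef_fb.
by case: (w =P v) => [<- //|_]; rewrite eqxx.
Qed.

Lemma supp_inW (X Y : pred K) g :
  (forall w, X w -> Y w) -> g \in supp_in X -> g \in supp_in Y.
Proof. by move=> XY /supp_inP gX; apply/supp_inP => w /gX /XY. Qed.

Lemma linear_eq_on (V : lmodType k) (X : pred K) (f h : {linear fmod -> V}) g :
  g \in supp_in X -> (forall w, X w -> f (fb w) = h (fb w)) -> f g = h g.
Proof.
move=> /supp_inP gX fh; rewrite [g]fmodE !linear_sum.
apply: eq_bigr => w _; rewrite !linearZ_LR.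
by have [->|/gX/fh->//] := eqVneq (fcoef w g) 0; rewrite !scale0r.
Qed.

Lemma linear_eq (V : lmodType k) (f h : {linear fmod -> V}) :
  (forall w, f (fb w) = h (fb w)) -> f =1 h.
Proof. by move=> fh g; apply: (@linear_eq_on V predT) => //; apply/supp_inP. Qed.

Lemma linear_mem (V : lmodType k) (W : submodClosed V) (X : pred K)
    (f : {linear fmod -> V}) g :
  g \in supp_in X -> (forall w, X w -> f (fb w) \in W) -> f g \in W.
Proof.
move=> /supp_inP gX fW; rewrite [g]fmodE linear_sum.
apply: rpred_sum => w _; rewrite linearZ_LR.
by have [->|/gX/fW fw] := eqVneq (fcoef w g) 0; rewrite ?scale0r ?rpred0 ?rpredZ.
Qed.

End FreeModule.

(** * Complexes of words twisted by a character *)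

Section Words.
Variables (k : fieldType) (nu : nat).

Local Notation mdegree := {ffun 'I_nu -> nat}.

Implicit Types (a b d : mdegree) (w v : seq mdegree) (i j : 'I_nu)
  (t : 'I_nu -> k).

Definition mle a b := [forall i, a i <= b i]%N.

Definition unitd i : mdegree := [ffun j => (j == i) : nat].
Definition subd a b : mdegree := [ffun j => (a j - b j)%N].
Definition wsum w : mdegree := \sum_(a <- w) a.

Lemma mleP a b : reflect (forall i, a i <= b i)%N (mle a b).
Proof. exact: forallP. Qed.

Lemma addd a b i : (a + b) i = (a i + b i)%N. Proof. by rewrite ffunE. Qed.
Lemma zerod i : (0 : mdegree) i = 0%N. Proof. by rewrite ffunE. Qed.
Lemma mulnd a m i : (a *+ m) i = (a i * m)%N.
Proof.
elim: m => [|m IH]; first by rewrite mulr0n muln0 zerod.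
by rewrite mulrS addd IH mulnS.
Qed.

Lemma wsum_nil : wsum [::] = 0. Proof. by rewrite /wsum big_nil. Qed.
Lemma wsum_cons a w : wsum (a :: w) = a + wsum w.
Proof. by rewrite /wsum big_cons. Qed.

Lemma mlerr a : mle a a. Proof. by apply/mleP. Qed.
Lemma mle_trans b a c : mle a b -> mle b c -> mle a c.
Proof. by move=> /mleP ab /mleP bc; apply/mleP => i; exact: leq_trans (bc i). Qed.
Lemma mle0 a : mle 0 a. Proof. by apply/mleP => i; rewrite zerod. Qed.

Lemma mle_add2l a b c : mle (a + b) (a + c) = mle b c.
Proof.
by apply/mleP/mleP => h i; have := h i; rewrite !addd; lia.
Qed.

Lemma mle_add2r a b c : mle (b + a) (c + a) = mle b c.
Proof. by rewrite ![_ + a]addrC mle_add2l. Qed.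

Lemma mle_addl a b : mle a (b + a).
Proof. by apply/mleP => i; rewrite addd; lia. Qed.

Lemma mle_addr a b : mle a (a + b).
Proof. by apply/mleP => i; rewrite addd; lia. Qed.

(** The character of the monoid of degrees with value t i at e_i; 0 ^+ 0 = 1 makes
the value 0 harmless. *)
Definition dchar t a : k := \prod_i t i ^+ a i.

Lemma dchar0 t : dchar t 0 = 1.
Proof. by apply: big1 => i _; rewrite zerod. Qed.

Lemma dcharD t a b : dchar t (a + b) = dchar t a * dchar t b.
Proof. by rewrite -big_split /=; apply: eq_bigr => i _; rewrite addd exprD. Qed.

Local Notation G := (fmod k (seq mdegree)).
Local Notation bw := (@fb k (seq mdegree)).

Definition consl a : {linear G -> G} := fext (fun w => bw (a :: w)).

Lemma consl1 a w : consl a (bw w) = bw (a :: w).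
Proof. exact: fextE. Qed.

(** The faces of index at least 1, with alternating signs starting from +: the
neighbours of a word are merged, and its last letter a is replaced by the scalar
dchar t a. This is the differential of a bar resolution. *)
Fixpoint tailw t w : G :=
  match w with
  | [::] => 0
  | a :: w' =>
    match w' with
    | [::] => dchar t a *: bw [::]
    | b :: w'' => bw ((a + b) :: w'') - consl a (tailw t w')
    end
  end.

Lemma tailw_nil t : tailw t [::] = 0. Proof. by []. Qed.
Lemma tailw1 t a : tailw t [:: a] = dchar t a *: bw [::].
Proof. by []. Qed.
Lemma tailw2 t a b w : tailw t [:: a, b & w] =
  bw ((a + b) :: w) - consl a (tailw t (b :: w)).
Proof. by []. Qed.
Arguments tailw : simpl never.

Definition tail t : {linear G -> G} := fext (tailw t).

Lemma tailE t w : tail t (bw w) = tailw t w.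
Proof. exact: fextE. Qed.

(** The face of index 0 deletes the first letter, which the implicit letter a_0
absorbs. *)
Definition bdryw t w : G :=
  match w with [::] => 0 | a :: w' => bw w' - tailw t w end.

Definition bdry t : {linear G -> G} := fext (bdryw t).

Lemma bdryE t w : bdry t (bw w) = bdryw t w.
Proof. exact: fextE. Qed.

Lemma tail_cons2 t a b g :
  tail t (consl a (consl b g)) = consl (a + b) g - consl a (tail t (consl b g)).
Proof.
pose f : {linear G -> G} := tail t \o (consl a \o consl b).
pose h : {linear G -> G} := consl (a + b) \- (consl a \o (tail t \o consl b)).
rewrite -[LHS]/(f g) -[RHS]/(h g); apply: linear_eq => w.
by rewrite /= !consl1 !tailE tailw2.
Qed.

(** Expanding twice, the terms that merge the first two or three letters cancel,
and what remains is the same square on the word without its first letter. *)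
Lemma tail_tail t w : tail t (tailw t w) = 0.
Proof.
elim: w => [|a w IH]; first exact: linear0.
case: w IH => [|b w] IH.
  by rewrite tailw1 linearZ /= tailE tailw_nil scaler0.
case: w IH => [|c w] IH.
  rewrite tailw2 tailw1 linearB !linearZ /= !consl1 !tailE !tailw1 dcharD.
  by rewrite scalerN scalerA [dchar t b * _]mulrC subrr.
have {}IH : tail t (consl b (tailw t (c :: w))) = tailw t ((b + c) :: w).
  by apply/esym/eqP; rewrite -subr_eq0 -tailE -linearB /= -tailw2 IH.
rewrite tailw2 [tailw t [:: b, c & w]]tailw2 !linearB /= tail_cons2 IH.
rewrite consl1 !tailE !tailw2.
by rewrite [a + (b + c)]addrA !opprB [X in _ + X]addrC !subrKA subrr.
Qed.

Lemma bdry_consl t a g : bdry t (consl a g) = g - tail t (consl a g).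
Proof.
pose f : {linear G -> G} := bdry t \o consl a.
pose h : {linear G -> G} := idfun \- (tail t \o consl a).
rewrite -[LHS]/(f g) -[RHS]/(h g); apply: linear_eq => w.
by rewrite /= consl1 bdryE tailE.
Qed.

Lemma bdry_bdry t g : bdry t (bdry t g) = 0.
Proof.
pose f : {linear G -> G} := bdry t \o bdry t.
rewrite -[LHS]/(f g) -[RHS]/((\0 : {linear G -> G}) g); apply: linear_eq => w /=.
rewrite bdryE; case: w => [|a [|b w]] /=; first exact: linear0.
  by rewrite tailw1 linearB linearZ /= bdryE /= scaler0 subrr.
have := tail_tail t [:: a, b & w].
rewrite tailw2 !linearB /= tailE bdry_consl !bdryE /= => /eqP.
rewrite subr_eq0 => /eqP ->.
by rewrite opprB !opprD !opprK [X in _ + X]addrC !subrKA subrr.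
Qed.

(** The subcomplex of words of sum at most d. *)
Definition below d : {pred G} := supp_in (fun w => mle (wsum w) d).
HB.instance Definition _ d := GRing.SubmodClosed.on (below d).

Lemma consl_supp (X Y : pred (seq mdegree)) a g :
  (forall w, X w -> Y (a :: w)) -> g \in supp_in X -> consl a g \in supp_in Y.
Proof.
move=> XY gX; apply: (linear_mem gX) => w /XY Yw.
by rewrite /= consl1; apply: supp_in_basis.
Qed.

Lemma tailw_below t w : tailw t w \in below (wsum w).
Proof.
elim: w => [|a [|b w] IH]; first exact: rpred0.
  by rewrite tailw1 rpredZ // supp_in_basis // wsum_nil mle0.
rewrite tailw2 rpredB //.
  by apply: supp_in_basis; rewrite !wsum_cons addrA mlerr.
by apply: consl_supp IH => v; rewrite ![wsum (a :: _)]wsum_cons mle_add2l.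
Qed.

Lemma bdry_below t d g : g \in below d -> bdry t g \in below d.
Proof.
move=> gd; apply: (linear_mem gd) => -[|a w] wd; rewrite /= bdryE ?rpred0 //=.
rewrite rpredB //.
  apply: supp_in_basis; apply: mle_trans wd.
  by rewrite wsum_cons mle_addl.
by apply: supp_inW (tailw_below _ _) => v /mle_trans; apply.
Qed.

Definition agree_off i t t' := forall j, j != i -> t j = t' j.

Lemma dchar_agree i t t' a : agree_off i t t' -> a i = 0%N -> dchar t a = dchar t' a.
Proof.
move=> tt' a0; apply: eq_bigr => j _.
by have [->|/tt' ->//] := eqVneq j i; rewrite a0.
Qed.

(** Only the last face depends on the character, and its coefficient changes only
if the deleted letter has a positive i-th coordinate. *)
Lemma tailw_diff i t t' w : agree_off i t t' ->
  tailw t w - tailw t' w \in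
    supp_in (fun v => mle (wsum v + unitd i) (wsum w)).
Proof.
move=> tt'; elim: w => [|a [|b w] IH]; first by rewrite subrr rpred0.
  rewrite !tailw1 -scalerBl; case: (posnP (a i)) => [a0|a_gt0].
    by rewrite (dchar_agree tt' a0) subrr scale0r rpred0.
  apply/rpredZ/supp_in_basis; rewrite wsum_nil add0r wsum_cons wsum_nil addr0.
  by apply/mleP => j; rewrite ffunE; case: eqVneq => // ->.
rewrite !tailw2 opprB addrC subrKA -opprB rpredN -linearB.
by apply: consl_supp IH => v; rewrite ![wsum (a :: _)]wsum_cons -addrA mle_add2l.
Qed.

Lemma bdry_diff i t t' d g : agree_off i t t' -> g \in below d ->
  bdry t g - bdry t' g \in supp_in (fun v => mle (wsum v + unitd i) d).
Proof.
move=> tt' gd; pose f : {linear G -> G} := bdry t \- bdry t'.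
rewrite -[_ - _]/(f g); apply: (linear_mem gd) => -[|a w] wd.
  by rewrite /= !bdryE subrr rpred0.
rewrite /= !bdryE /= opprB addrC subrKA -opprB rpredN.
by apply: supp_inW (tailw_diff _ tt') => v /mle_trans; apply.
Qed.

Lemma bdry_diff_below i t t' d g : agree_off i t t' -> g \in below (d + unitd i) ->
  bdry t g - bdry t' g \in below d.
Proof.
move=> tt' gd; apply: supp_inW (bdry_diff tt' gd) => v.
by rewrite mle_add2r.
Qed.

Lemma bdry_agree i t t' d g : agree_off i t t' -> d i = 0%N -> g \in below d ->
  bdry t g = bdry t' g.
Proof.
move=> tt' d0 gd; apply/eqP; rewrite -subr_eq0; apply/eqP.
pose f : {linear G -> G} := idfun; pose h : {linear G -> G} := \0.
apply: (linear_eq_on (f := f) (h := h) (bdry_diff tt' gd)) => v /mleP /(_ i).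
by rewrite d0 addd ffunE eqxx addn1.
Qed.

Definition acyclic t d := forall z, z \in below d -> bdry t z = 0 ->
  exists2 u, u \in below d & bdry t u = z.

Lemma below_add d c g : g \in below d -> g \in below (d + c).
Proof. by apply: supp_inW => w /mle_trans; apply; apply: mle_addr. Qed.

(** For t', the cycle z has its boundary in the smaller subcomplex, so it can be
corrected there to a cycle for t', which is the t'-boundary of some u; the two
boundaries of u differ by an element of the smaller subcomplex. *)
Lemma acyclic_switch i t t' d z : agree_off i t t' ->
    acyclic t' d -> acyclic t' (d + unitd i) ->
    z \in below (d + unitd i) -> bdry t z = 0 ->
  exists2 u, u \in below (d + unitd i) & z - bdry t u \in below d.
Proof.
move=> tt' ac_d ac_di zd tz.
have t'z : bdry t' z \in below d.
  by have := bdry_diff_below tt' zd; rewrite tz sub0r rpredN.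
have [y yd ty] := ac_d _ t'z (bdry_bdry _ _).
have [||u ud tu] := ac_di (z - y); first by rewrite rpredB // below_add.
  by rewrite linearB /= ty subrr.
exists u => //; have := bdry_diff_below tt' ud.
by rewrite tu -rpredN opprB; move/(rpredD yd); rewrite addrA [y + _]addrC subrK.
Qed.

Lemma acyclic_step i t t' d : agree_off i t t' ->
  acyclic t' d -> acyclic t' (d + unitd i) -> acyclic t d ->
  acyclic t (d + unitd i).
Proof.
move=> tt' ac_d ac_di ac z zd tz.
have [u ud zu] := acyclic_switch tt' ac_d ac_di zd tz.
have [|v vd tv] := ac _ zu; first by rewrite linearB /= tz bdry_bdry subrr.
exists (u + v); first by rewrite rpredD // below_add.
by rewrite linearD /= tv addrC subrK.
Qed.

(** Makes the implicit letter a_0 = d - wsum w explicit and leaves 0 in its place. *)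
Definition fillw d w : G := bw (subd d (wsum w) :: w).
Definition fill d : {linear G -> G} := fext (fillw d).

Lemma fillE d w : fill d (bw w) = bw (subd d (wsum w) :: w).
Proof. exact: fextE. Qed.

Lemma fill_below d g : g \in below d -> fill d g \in below d.
Proof.
move=> gd; apply: (linear_mem gd) => w /mleP wd; rewrite /= fillE.
apply: supp_in_basis; rewrite wsum_cons; apply/mleP => i.
by rewrite addd ffunE subnK.
Qed.

(** A last face with nonzero coefficient deletes the letter 0, so no face of
positive index changes the sum of the word. *)
Lemma tailw_wsum t d w : (forall a, mle a d -> a != 0 -> dchar t a = 0) ->
  mle (wsum w) d -> tailw t w \in supp_in (fun v => wsum v == wsum w).
Proof.
move=> t0; elim: w => [|a [|b w] IH]; first by rewrite rpred0.
  rewrite wsum_cons wsum_nil addr0 tailw1 => ad.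
  have [->|a0] := eqVneq a 0; last by rewrite t0 // scale0r rpred0.
  by rewrite rpredZ // supp_in_basis // wsum_nil.
move=> wd; rewrite tailw2 rpredB //.
  by apply: supp_in_basis; rewrite !wsum_cons addrA.
have /IH : mle (wsum (b :: w)) d.
  by apply: mle_trans wd; rewrite [wsum (a :: _)]wsum_cons mle_addl.
by apply: consl_supp => v /eqP e; rewrite ![wsum (a :: _)]wsum_cons e.
Qed.

(** The projection onto the empty word, scaled by c. *)
Definition constw (c : k) (g : G) : G := (c * fcoef [::] g) *: bw [::].

Lemma constw_linear (c : k) : linear (constw c).
Proof.
move=> a x y; rewrite /constw fcoef_linear mulrDr scalerDl scalerA.
by congr (_ *: _ + _); rewrite mulrCA.
Qed.

HB.instance Definition _ (c : k) :=
  GRing.isLinear.Build k G G *:%R (constw c) (constw_linear c).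

(** With a_0 explicit, the face of index 0 gives the word back, and the other faces
commute with fill since they preserve the sum. The empty word is special: its
completion (d) has the further face dchar t d. *)
Lemma fill_homotopy t d g : (forall a, mle a d -> a != 0 -> dchar t a = 0) ->
  g \in below d ->
  bdry t (fill d g) + fill d (bdry t g) = g - constw (dchar t d) g.
Proof.
move=> t0 gd; pose f : {linear G -> G} := (bdry t \o fill d) \+ (fill d \o bdry t).
pose h : {linear G -> G} := idfun \- constw (dchar t d).
rewrite -[LHS]/(f g) -[RHS]/(h g); apply: (linear_eq_on gd) => w wd /=.
rewrite /constw fillE !bdryE; case: w wd => [|b w] wd.
  rewrite fcoef_fb eqxx mulr1 linear0 addr0 /bdryw tailw1 wsum_nil.
  by congr (_ - dchar _ _ *: _); apply/ffunP => i; rewrite !ffunE subn0.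
rewrite fcoef_fb mulr0 scale0r subr0 /bdryw tailw2.
rewrite [fill d _]linearB /= fillE.
have -> : fill d (tailw t (b :: w)) =
    consl (subd d (wsum (b :: w))) (tailw t (b :: w)).
  apply: (linear_eq_on (tailw_wsum t0 wd)) => v /eqP e.
  by rewrite /= fillE consl1 e.
have -> : subd d (wsum (b :: w)) + b = subd d (wsum w).
  apply/ffunP => i; move/mleP/(_ i): wd.
  rewrite wsum_cons /subd [in RHS]ffunE !(addd, ffunE) => wd; lia.
by rewrite opprB -addrA subrKA subrr addr0.
Qed.

Definition setv t i (c : k) : 'I_nu -> k := fun j => if j == i then c else t j.

Lemma setvE t i c : setv t i c i = c. Proof. by rewrite /setv eqxx. Qed.

Lemma agree_setv t i c : agree_off i t (setv t i c).
Proof. by move=> j /negPf ji; rewrite /setv ji. Qed.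

Lemma agree_setv2 t i c c' : agree_off i (setv t i c) (setv t i c').
Proof. by move=> j /negPf ji; rewrite /setv ji. Qed.

Lemma subd_unitK d j : (0 < d j)%N -> subd d (unitd j) + unitd j = d.
Proof.
move=> dj; apply/ffunP => l; rewrite addd !ffunE.
by case: eqVneq => [->|_]; rewrite ?subnK // subn0 addn0.
Qed.

Lemma coord_ind j (P : mdegree -> Prop) :
    (forall d, d j = 0%N -> P d) -> (forall d, P d -> P (d + unitd j)) ->
  forall d, P d.
Proof.
move=> P0 PS d; move: {2}(d j) (erefl (d j)) => m.
elim: m d => [|m IH] d dj; first exact: P0.
rewrite -(@subd_unitK d j) ?dj //; apply/PS/IH.
by rewrite !ffunE eqxx dj subn1.
Qed.

Lemma dchar_eq0 t a : (forall j, t j = 0) -> a != 0 -> dchar t a = 0.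
Proof.
move=> t0 a0; have [j aj] : exists j, a j != 0%N.
  apply/existsP; rewrite -negb_forall; apply: contra a0 => /forallP a0.
  by apply/eqP/ffunP => j; rewrite zerod; apply/eqP.
by rewrite /dchar (bigD1 j) //= t0 expr0n (negPf aj) mul0r.
Qed.

(** When t is 0 everywhere, fill contracts every nonzero degree. In general, by
induction on a list of generators outside which t vanishes: replacing t j by 0
shortens the list, and the switch lemma restores t j, by induction on d j. *)
Lemma acyclic_vanishing t i d : t i = 0 -> acyclic t (d + unitd i).
Proof.
have [s] : exists s : seq 'I_nu, forall j, j \notin s -> t j = 0.
  by exists (enum 'I_nu) => j; rewrite mem_enum.
elim: s t d => [|j s IH] t d st ti.
  have t0 j : t j = 0 by apply: st.
  move=> z zd tz; exists (fill (d + unitd i) z); first exact: fill_below.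
  have := fill_homotopy (fun a _ => @dchar_eq0 t a t0) zd.
  rewrite tz linear0 addr0 => ->; rewrite dchar_eq0 //.
    by rewrite /constw mul0r scale0r subr0.
  by apply/eqP => /ffunP /(_ i); rewrite addd !ffunE eqxx addn1.
have [e|ji] := eqVneq j i.
  apply: IH => // l ls; have [->|li] := eqVneq l i; first by [].
  by apply: st; rewrite inE e negb_or li.
have ac t' : agree_off j t t' -> t' j = 0 -> forall d, acyclic t' (d + unitd i).
  move=> tt' t'j d'; apply: IH => [l ls|]; last by rewrite -tt' // eq_sym.
  have [->//|lj] := eqVneq l j.
  by rewrite -tt' // st // inE negb_or lj.
have {}ac := ac _ (@agree_setv t j 0) (setvE t j 0).
elim/(@coord_ind j): d => [d dj|d ac_d].
  move=> z zd tz; have dij : (d + unitd i) j = 0%N.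
    by rewrite addd dj ffunE (negPf ji).
  rewrite (bdry_agree (@agree_setv t j 0) dij zd) in tz.
  have [u ud tu] := ac _ _ zd tz; exists u => //.
  by rewrite (bdry_agree (@agree_setv t j 0) dij ud).
rewrite addrAC; apply: acyclic_step (@agree_setv t j 0) _ _ ac_d => //.
by rewrite addrAC.
Qed.

Definition erased i a : mdegree := [ffun j => if j == i then 0%N else a j].

Definition erase i : {linear G -> G} := fext (fun w => bw (map (erased i) w)).

Lemma eraseE i w : erase i (bw w) = bw (map (erased i) w).
Proof. exact: fextE. Qed.

Lemma erasedD i a b : erased i (a + b) = erased i a + erased i b.
Proof. by apply/ffunP => j; rewrite addd !ffunE; case: eqP. Qed.

Lemma erase_consl i a g : erase i (consl a g) = consl (erased i a) (erase i g).
Proof.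
pose f : {linear G -> G} := erase i \o consl a.
pose h : {linear G -> G} := consl (erased i a) \o erase i.
rewrite -[LHS]/(f g) -[RHS]/(h g); apply: linear_eq => w.
by rewrite /= consl1 !eraseE consl1.
Qed.

Lemma dchar_erased t i a : t i = 1 -> dchar t (erased i a) = dchar t a.
Proof.
move=> ti; apply: eq_bigr => j _; rewrite ffunE.
by case: eqVneq => // ->; rewrite ti !expr1n.
Qed.

Lemma erase_tailw t i w : t i = 1 ->
  erase i (tailw t w) = tailw t (map (erased i) w).
Proof.
move=> ti; elim: w => [|a [|b w] IH]; first exact: linear0.
  by rewrite /= !tailw1 linearZ /= eraseE dchar_erased.
by rewrite /= !tailw2 linearB /= eraseE erase_consl IH /= erasedD.
Qed.

(** Setting the i-th variable to 1 is compatible with the faces when the character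
does not see that variable. *)
Lemma erase_bdry t i g : t i = 1 -> erase i (bdry t g) = bdry t (erase i g).
Proof.
move=> ti; pose f : {linear G -> G} := erase i \o bdry t.
pose h : {linear G -> G} := bdry t \o erase i.
rewrite -[LHS]/(f g) -[RHS]/(h g); apply: linear_eq => -[|a w] /=.
  by rewrite eraseE !bdryE linear0.
rewrite eraseE !bdryE /= linearB /= eraseE.
by rewrite -[erased i a :: _]/(map _ (a :: w)) erase_tailw.
Qed.

Lemma wsum_erased i w : wsum (map (erased i) w) = erased i (wsum w).
Proof.
elim: w => [|a w IH] /=; last by rewrite !wsum_cons erasedD IH.
by rewrite wsum_nil; apply/ffunP => j; rewrite !ffunE if_same.
Qed.

Lemma erase_below i d g : d i = 0%N -> g \in below (d + unitd i) ->
  erase i g \in below d.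
Proof.
move=> di gd; apply: (linear_mem gd) => w /mleP wd.
rewrite /= eraseE; apply: supp_in_basis; rewrite wsum_erased.
apply/mleP => j; have := wd j; rewrite addd !ffunE.
by case: eqVneq => // _; rewrite addn0.
Qed.

Lemma erased_id i d a : d i = 0%N -> mle a d -> erased i a = a.
Proof.
move=> di /mleP ad; apply/ffunP => j; rewrite ffunE.
by case: eqVneq => // ->; have := ad i; rewrite di leqn0 => /eqP.
Qed.

Lemma erase_id i d g : d i = 0%N -> g \in below d -> erase i g = g.
Proof.
move=> di gd.
apply: (linear_eq_on (f := erase i) (h := idfun : {linear G -> G}) gd) => w wd.
rewrite eraseE /=; congr fb; elim: w wd => //= a w IH.
rewrite wsum_cons => awd; rewrite IH; last exact: mle_trans (mle_addl _ _) awd.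
by rewrite (erased_id di (mle_trans (mle_addr _ _) awd)).
Qed.

(** A power of exponent at most 1 is affine, so it interpolates its values at 0
and 1. *)
Lemma dchar_affine t i a : (a i <= 1)%N ->
  dchar t a = (1 - t i) * dchar (setv t i 0) a + t i * dchar (setv t i 1) a.
Proof.
move=> ai; have e c : \prod_(j | j != i) setv t i c j ^+ a j =
    \prod_(j | j != i) t j ^+ a j.
  by apply: eq_bigr => j /negPf ji; rewrite /setv ji.
have D1 t' : dchar t' a = t' i ^+ a i * \prod_(j | j != i) t' j ^+ a j.
  by rewrite /dchar (bigD1 i).
rewrite !D1 !setvE !e.
by move: (a i) ai => [|[|]] // _; rewrite ?expr0 ?expr1; ring.
Qed.

Lemma tailw_affine t i w : (wsum w i <= 1)%N -> tailw t w =
  (1 - t i) *: tailw (setv t i 0) w + t i *: tailw (setv t i 1) w.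
Proof.
elim: w => [|a [|b w] IH]; first by rewrite !scaler0 addr0.
  rewrite wsum_cons wsum_nil addr0 !tailw1 !scalerA -scalerDl => ai.
  by rewrite (dchar_affine t ai).
rewrite wsum_cons addd => abw; rewrite !tailw2 IH; last by lia.
rewrite linearD !linearZ /= !scalerBr addrACA -opprD -scalerDl subrK.
by rewrite scale1r.
Qed.

Lemma bdry_affine t i d g : d i = 0%N -> g \in below (d + unitd i) ->
  bdry t g = (1 - t i) *: bdry (setv t i 0) g + t i *: bdry (setv t i 1) g.
Proof.
move=> di gd.
pose h : {linear G -> G} :=
  ((1 - t i) \*: bdry (setv t i 0)) \+ (t i \*: bdry (setv t i 1)).
rewrite -[RHS]/(h g); apply: (linear_eq_on gd) => -[|a w] wd /=.
  by rewrite !bdryE !scaler0 addr0.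
rewrite !bdryE /= (@tailw_affine t i); last first.
  by move/mleP/(_ i): wd; rewrite addd di ffunE eqxx.
by rewrite !scalerBr addrACA -opprD -scalerDl subrK scale1r.
Qed.

(** Write D_0, D_1 for the differentials with value 0, 1 at i. If D_0 z lies below
d, then so does D_1 z, which erase i fixes; hence D_1 z is the boundary of
erase i z. Dividing by 1 - t i then turns D_0-boundaries into t-boundaries. *)
Lemma acyclic_unit t i d : d i = 0%N -> t i != 1 -> acyclic t (d + unitd i).
Proof.
move=> di ti; have ti1 : 1 - t i != 0 by rewrite subr_eq0 eq_sym.
pose t0 := setv t i 0; pose t1 := setv t i 1.
(* Below d all three differentials agree, and erase i is the identity. *)
have bdry1 z : z \in below (d + unitd i) -> bdry t0 z \in below d ->
    bdry t1 z = bdry t (erase i z).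
  move=> zd tz; have t1z : bdry t1 z \in below d.
    have := bdry_diff_below (@agree_setv2 t i 1 0) zd.
    by move/(rpredD tz); rewrite addrC subrK.
  rewrite -(erase_id di t1z) erase_bdry; last exact: setvE.
  by rewrite (bdry_agree (@agree_setv t i 1) di) // erase_below.
have ac0 := @acyclic_vanishing t0 i d (setvE t i 0).
(* A cycle v below d is D_0 u for some u, and the t-boundary of u is (1 - t i) v
   plus t i times the boundary of erase i u. *)
have sub_case (v : G) : v \in below d -> bdry t v = 0 ->
    exists2 u, u \in below (d + unitd i) & bdry t u = v.
  move=> vd tv; have [||u ud t0u] := ac0 v; first exact: below_add.
    by rewrite -(bdry_agree (@agree_setv t i 0) di vd).
  exists ((1 - t i)^-1 *: (u - t i *: erase i u)).
    by rewrite rpredZ // rpredB // rpredZ // below_add // erase_below.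
  rewrite linearZ linearB linearZ /= (bdry_affine t di ud) -/t0 -/t1 t0u.
  by rewrite bdry1 ?t0u // addrK scalerA mulVf // scale1r.
move=> z zd tz.
have t0zd : bdry t0 z \in below d.
  have := bdry_diff_below (@agree_setv t i 0) zd.
  by rewrite tz sub0r rpredN.
(* y is chosen below d with D_0 y = D_0 z, so z - y is a D_0-boundary. *)
pose y := - ((1 - t i)^-1 * t i) *: erase i z.
have yd : y \in below d by rewrite rpredZ // erase_below.
have t0z : bdry t0 z = bdry t0 y.
  rewrite -(bdry_agree (@agree_setv t i 0) di yd) linearZ /= -bdry1 //.
  apply: (scalerI ti1); move: tz; rewrite (bdry_affine t di zd) => /eqP.
  by rewrite addr_eq0 => /eqP ->; rewrite scalerA mulrN mulrA mulfV // mul1r scaleNr.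
have [||u ud t0u] := ac0 (z - y); first by rewrite rpredB // below_add.
  by rewrite linearB /= t0z subrr.
have zud : z - bdry t u \in below d.
  have := bdry_diff_below (@agree_setv t i 0) ud.
  rewrite -/t0 t0u -rpredN opprB => /(rpredD yd).
  by rewrite addrA [y + _]addrC subrK.
have [|v vd tv] := sub_case _ zud; first by rewrite linearB /= tz bdry_bdry subrr.
exists (u + v); first by rewrite rpredD.
by rewrite linearD /= tv addrC subrK.
Qed.

Lemma acyclic_neq1 t i d : t i != 1 -> acyclic t (d + unitd i).
Proof.
move=> ti; elim/(@coord_ind i): d => [d di|d ac]; first exact: acyclic_unit.
by apply: acyclic_step (@agree_setv t i 0) _ _ ac;
  apply: acyclic_vanishing; rewrite setvE.
Qed.

(** For m at least 2 the switch lemma lowers m. For m = 0 all letters are 0 and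
fill contracts everything but the empty word. For m = 1 the word (e_i) is a
cycle for t, but its boundary is the empty word when the value at i is 0. *)
Lemma one_variable t i m z : t i = 1 -> z \in below (unitd i *+ m) ->
    bdry t z = 0 ->
  exists u c0 c1, u \in below (unitd i *+ m) /\
    z = bdry t u + c0 *: bw [::] + c1 *: bw [:: unitd i].
Proof.
move=> ti.
have base t' (v : G) : v \in below 0 -> bdry t' v = 0 ->
    exists u c0, u \in below 0 /\ v = bdry t' u + c0 *: bw [::].
  move=> v0 tv; exists (fill 0 v), (fcoef [::] v); split; first exact: fill_below.
  have := fill_homotopy (t := t') (d := 0) _ v0; rewrite tv linear0 addr0 => ->; last first.
    move=> a /mleP a0; case/eqP; apply/ffunP => j.
    by have := a0 j; rewrite zerod leqn0 => /eqP.
  by rewrite /constw dchar0 mul1r subrK.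
have tb : bdry t (bw [:: unitd i]) = 0.
  rewrite bdryE /= tailw1 /dchar (bigD1 i) //= ti expr1n mul1r big1 => [|j /negPf ji].
    by rewrite scale1r subrr.
  by rewrite ffunE ji.
have t0b : bdry (setv t i 0) (bw [:: unitd i]) = bw [::].
  rewrite bdryE /= tailw1 /dchar (bigD1 i) //= setvE ffunE eqxx expr1 mul0r.
  by rewrite scale0r subr0.
elim: m z => [|m IH] z.
  rewrite mulr0n => z0 tz; have [u [c0 [u0 ->]]] := base t z z0 tz.
  by exists u, c0, 0; rewrite scale0r addr0.
rewrite mulrSr => zd tz; case: m IH zd => [|m] IH zd.
  rewrite mulr0n in IH zd *.
  have zi : (0 : mdegree) i = 0%N by rewrite zerod.
  have t0zd : bdry (setv t i 0) z \in below 0.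
    have := bdry_diff_below (@agree_setv t i 0) zd.
    by rewrite tz sub0r rpredN.
  have [y [c [yd t0z]]] := base _ _ t0zd (bdry_bdry _ _).
  have bd : bw [:: unitd i] \in below (0 + unitd i).
    by apply: supp_in_basis; rewrite wsum_cons wsum_nil addr0 add0r mlerr.
  have [||u ud t0u] := @acyclic_vanishing (setv t i 0) i 0 (setvE t i 0)
      (z - y - c *: bw [:: unitd i]).
  - by rewrite !rpredB ?rpredZ // below_add.
  - by rewrite !linearB linearZ /= t0z t0b addrAC addrK subrr.
  pose v := z - bdry t u - c *: bw [:: unitd i].
  have vd : v \in below 0.
    have := bdry_diff_below (@agree_setv t i 0) ud.
    rewrite t0u -rpredN opprB => /(rpredD yd).
    by rewrite !addrA [y + z]addrC addrK addrAC.
  have [|u' [c0 [u'd vE]]] := base t v vd.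
    by rewrite !linearB linearZ /= tz bdry_bdry tb scaler0 !subrr.
  exists (u + u'), c0, c; split; first by rewrite rpredD // below_add.
  rewrite linearD /= -!addrA [_ + (c0 *: _ + _)]addrA -vE /v.
  by rewrite subrK addrC subrK.
have [||u ud zu] := acyclic_switch (@agree_setv t i 0) _ _ zd tz.
- by rewrite mulrSr; apply: acyclic_vanishing; rewrite setvE.
- by apply: acyclic_vanishing; rewrite setvE.
have [|v [c0 [c1 [vd e]]]] := IH _ zu.
  by rewrite linearB /= tz bdry_bdry subrr.
exists (u + v), c0, c1; split; first by rewrite rpredD // below_add.
by rewrite linearD /= -!addrA [bdry t v + _]addrA -e addrC subrK.
Qed.

End Words.

Arguments tailw : simpl never.
Arguments fill {k nu} d.
Arguments consl {k nu} a.
Arguments below {k nu} d _.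

(** * The monomial basis of the affine space *)

(** Compatibility with a bilinear product can be checked on a spanning family. *)
Lemma bilinear_mult (k : fieldType) (F : algType k) (V : lmodType k) (M : Type)
    (fw : M -> F) (star : V -> V -> V) (phi : {linear F -> V}) :
    (forall h, linear (star h)) -> (forall h, linear (star^~ h)) ->
    (forall f, exists r (c : M -> k), f = \sum_(m <- r) c m *: fw m) ->
    (forall m n, phi (fw m * fw n) = star (phi (fw m)) (phi (fw n))) ->
  forall f g, phi (f * g) = star (phi f) (phi g).
Proof.
move=> starr starl span mult f g.
pose sr h : {linear V -> V} := HB.pack (star h)
  (GRing.isLinear.Build _ _ _ _ (star h) (starr h)).
pose sl h : {linear V -> V} := HB.pack (star^~ h)
  (GRing.isLinear.Build _ _ _ _ (star^~ h) (starl h)).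
have [r [c ->]] := span f; rewrite mulr_suml !linear_sum.
rewrite -[RHS]/(sl (phi g) _) linear_sum; apply: eq_bigr => m _.
rewrite -scalerAl !linearZ_LR; congr (_ *: _).
have [s [e ->]] := span g; rewrite mulr_sumr linear_sum.
rewrite -[RHS]/(sr (phi (fw m)) _) !linear_sum; apply: eq_bigr => n _.
by rewrite -scalerAr !linearZ_LR mult.
Qed.

Section AffineBasis.
Variables (k : fieldType) (nu : nat) (Lambda : 'M[k]_nu).
Hypothesis Lambda_neq0 : forall i j, Lambda i j != 0.
Hypothesis Lambda_diag : forall i, Lambda i i = 1.
Hypothesis Lambda_inv :
  forall i j : 'I_nu, (i < j)%N -> Lambda i j * Lambda j i = 1.
Local Notation mdegree := {ffun 'I_nu -> nat}.
Implicit Types (a b d : mdegree) (w v : seq mdegree) (i j : 'I_nu).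

(** In x_j x^b, the factor x_j moves past the powers x_i^(b i) with i < j, which
costs lowc b j. The resulting factor coc a b in x^a x^b = coc a b x^(a+b) is a
character of a with values lowc b, and a character of b with values highc a. *)
Definition lowc b j : k := \prod_(i < nu | (i < j)%N) Lambda i j ^+ b i.
Definition highc a i : k := \prod_(j < nu | (i < j)%N) Lambda i j ^+ a j.
Definition coc a b : k := dchar (lowc b) a.

Lemma lowcD a b j : lowc (a + b) j = lowc a j * lowc b j.
Proof. by rewrite -big_split; apply: eq_bigr => i _; rewrite addd exprD. Qed.

Lemma lowc0 j : lowc 0 j = 1.
Proof. by apply: big1 => i _; rewrite zerod. Qed.

Lemma lowc_neq0 b j : lowc b j != 0.
Proof. by apply/prodf_neq0 => i _; rewrite expf_neq0. Qed.

Lemma coc_neq0 a b : coc a b != 0.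
Proof. by apply/prodf_neq0 => i _; rewrite expf_neq0 ?lowc_neq0. Qed.

Lemma coc0l b : coc 0 b = 1. Proof. exact: dchar0. Qed.

Lemma cocDl a b d : coc (a + b) d = coc a d * coc b d.
Proof. exact: dcharD. Qed.

Lemma cocDr a b d : coc a (b + d) = coc a b * coc a d.
Proof. by rewrite -big_split; apply: eq_bigr => i _; rewrite lowcD exprMn. Qed.

Lemma coc0r a : coc a 0 = 1.
Proof. by apply: big1 => i _; rewrite lowc0 expr1n. Qed.

Lemma dchar_unitd t i : dchar t (unitd i) = t i :> k.
Proof.
rewrite /dchar (bigD1 i) //= ffunE eqxx big1 ?mulr1 // => j /negPf ji.
by rewrite ffunE ji.
Qed.

Lemma coc_unitl i b : coc (unitd i) b = lowc b i.
Proof. exact: dchar_unitd. Qed.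

Lemma coc_highc a b : coc a b = dchar (highc a) b.
Proof.
rewrite /coc /dchar.
rewrite (eq_bigr (fun j => \prod_(i < nu | (i < j)%N) Lambda i j ^+ (b i * a j))).
  rewrite (exchange_big_dep predT) //=; apply: eq_bigr => i _.
  by rewrite -prodrXl; apply: eq_bigr => j _; rewrite mulnC exprM.
by move=> j _; rewrite -prodrXl; apply: eq_bigr => i _; rewrite exprM.
Qed.

Definition degw (m : seq 'I_nu) : mdegree := \sum_(i <- m) unitd i.

(** The scalar that relates a word in the generators to its ordered monomial. *)
Fixpoint kappa (m : seq 'I_nu) : k :=
  if m is i :: m' then lowc (degw m') i * kappa m' else 1.

Lemma degw_cons i m : degw (i :: m) = unitd i + degw m.
Proof. by rewrite /degw big_cons. Qed.

Lemma degw_nil : degw [::] = 0. Proof. by rewrite /degw big_nil. Qed.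

Lemma degw_cat m n : degw (m ++ n) = degw m + degw n.
Proof. by rewrite /degw big_cat. Qed.

Lemma kappa_neq0 m : kappa m != 0.
Proof. by elim: m => [|i m IH] /=; rewrite ?oner_eq0 // mulf_neq0 ?lowc_neq0. Qed.

Lemma kappa_cat m n : kappa (m ++ n) = kappa m * kappa n * coc (degw m) (degw n).
Proof.
elim: m => [|i m IH] /=; first by rewrite degw_nil coc0l mul1r mulr1.
by rewrite IH degw_cat degw_cons lowcD cocDl coc_unitl; ring.
Qed.

Lemma unitd_sum a : a = \sum_i unitd i *+ a i.
Proof.
apply/ffunP => j; rewrite sum_ffunE (bigD1 j) //= mulnd ffunE eqxx mul1n.
by rewrite big1 ?addr0 // => i /negPf ij; rewrite mulnd ffunE eq_sym ij.
Qed.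

Lemma degw_surj a : exists m, degw m = a.
Proof.
rewrite (unitd_sum a); elim/big_ind: _ => [|b d [m <-] [n <-]|i _].
- by exists [::]; rewrite degw_nil.
- by exists (m ++ n); rewrite degw_cat.
exists (nseq (a i) i); elim: (a i) => [|n IH]; first by rewrite degw_nil mulr0n.
by rewrite degw_cons IH mulrS.
Qed.

Section Monomials.
Variables (A : algType k) (x : 'I_nu -> A).
Hypothesis x_rel : forall i j, x j * x i = Lambda i j *: (x i * x j).

Definition mon a : A := \prod_(i < nu) x i ^+ a i.

Lemma gen_commX i j n : x i * x j ^+ n = Lambda j i ^+ n *: (x j ^+ n * x i).
Proof.
elim: n => [|n IH]; first by rewrite !expr0 scale1r mulr1 mul1r.
rewrite [x j ^+ _]exprS mulrA x_rel -scalerAl -[x j * x i * _]mulrA IH -scalerAr.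
by rewrite scalerA exprS mulrA.
Qed.

Lemma gen_comm_prod i b (s : seq 'I_nu) :
  x i * \prod_(l <- s) x l ^+ b l =
  (\prod_(l <- s) Lambda l i ^+ b l) *: ((\prod_(l <- s) x l ^+ b l) * x i).
Proof.
elim: s => [|j s IH]; first by rewrite !big_nil scale1r mulr1 mul1r.
rewrite !big_cons mulrA gen_commX -scalerAl -[x j ^+ _ * x i * _]mulrA IH.
by rewrite -scalerAr scalerA mulrA.
Qed.

Lemma enum_split i : exists s1 s2, [/\ index_enum 'I_nu = s1 ++ i :: s2,
  forall l, l \in s1 -> (l < i)%N & forall l, l \in s2 -> (i < l)%N].
Proof.
rewrite [index_enum _]unlock -enumT.
have srt : sorted (fun p q : 'I_nu => (p < q)%N) (enum 'I_nu).
  by have := iota_ltn_sorted 0 nu; rewrite -val_enum_ord sorted_map.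
have [s1 [s2 es]] : exists s1 s2, enum 'I_nu = s1 ++ i :: s2.
  have : i \in enum 'I_nu by rewrite mem_enum.
  by case/path.splitPr => s1 s2; exists s1, s2.
have tr : transitive (fun p q : 'I_nu => (p < q)%N).
  by move=> p q r; exact: ltn_trans.
rewrite es (sorted_pairwise tr) pairwise_cat /= in srt.
 case/and3P: srt => /allrelP r1 _ /andP [/allP r2 _].
by exists s1, s2; split=> // l l1; apply: r1 => //; rewrite inE eqxx.
Qed.

Lemma gen_mon i b : x i * mon b = lowc b i *: mon (unitd i + b).
Proof.
have [s1 [s2 [es s1i s2i]]] := enum_split i.
have prodE (F : 'I_nu -> A) :
    \prod_(j < nu) F j = (\prod_(j <- s1) F j) * (F i * \prod_(j <- s2) F j).
  by rewrite es big_cat big_cons.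
have -> : lowc b i = \prod_(l <- s1) Lambda l i ^+ b l.
  rewrite /lowc es big_cat big_cons ltnn /=.
  rewrite [X in _ * X]big1_seq ?mulr1; last first.
    by move=> l /andP [li /s2i]; rewrite ltnNge ltnW.
  rewrite big_seq_cond [RHS]big_seq; apply: eq_bigl => l.
  by case: (boolP (l \in s1)) => // /s1i ->.
rewrite /mon !prodE mulrA gen_comm_prod -scalerAl -mulrA; congr (_ *: _).
have out_i l : l != i -> (unitd i + b) l = b l.
  by move=> /negPf li; rewrite addd ffunE li.
congr (_ * _).
  apply: eq_big_seq => l /s1i li; rewrite out_i //.
  by apply: contraTneq li => ->; rewrite ltnn.
rewrite mulrA addd ffunE eqxx exprS; congr (_ * _ * _).
apply: eq_big_seq => l /s2i li; rewrite out_i //.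
by apply: contraTneq li => ->; rewrite ltnn.
Qed.

Lemma word_mon m b : \prod_(i <- m) x i * mon b =
  (kappa m * coc (degw m) b) *: mon (degw m + b).
Proof.
elim: m => [|i m IH] /=.
  by rewrite big_nil mul1r degw_nil add0r coc0l mulr1 scale1r.
rewrite big_cons -mulrA IH -scalerAr gen_mon scalerA degw_cons addrA.
by rewrite lowcD cocDl coc_unitl; congr (_ *: _); ring.
Qed.

Lemma mon0 : mon 0 = 1.
Proof. by rewrite /mon big1 // => i _; rewrite zerod expr0. Qed.

Lemma wordE m : \prod_(i <- m) x i = kappa m *: mon (degw m).
Proof. by have := word_mon m 0; rewrite mon0 mulr1 coc0r mulr1 addr0. Qed.

Lemma monM a b : mon a * mon b = coc a b *: mon (a + b).
Proof.
have [m <-] := degw_surj a.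
apply: (scalerI (kappa_neq0 m)).
by rewrite scalerAl -wordE word_mon scalerA.
Qed.

Lemma mon_power i m : mon (unitd i *+ m) = x i ^+ m.
Proof.
rewrite /mon; have [s1 [s2 [es s1i s2i]]] := enum_split i.
rewrite es big_cat big_cons mulnd ffunE eqxx mul1n.
rewrite !big1_seq /= ?mul1r ?mulr1 // => l li; rewrite mulnd ffunE.
  by move: (s2i _ li); case: eqVneq => [->|_]; rewrite ?ltnn.
by move: (s1i _ li); case: eqVneq => [->|_]; rewrite ?ltnn.
Qed.

End Monomials.

Local Notation V := (fmod k mdegree).
Local Notation bV := (@fb k mdegree).

(** The product of the monoid algebra of degrees twisted by coc. *)
Definition twist (g h : V) : V :=
  fext (fun a => fext (fun b => coc a b *: bV (a + b)) h) g.

Lemma twist_fb a b : twist (bV a) (bV b) = coc a b *: bV (a + b).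
Proof. by rewrite /twist !fextE. Qed.

Lemma twist_linearr g : linear (twist g).
Proof.
move=> c h1 h2; rewrite /twist.
pose F h : {linear V -> V} := fext (fun a => fext (fun b => coc a b *: bV (a + b)) h).
pose H : {linear V -> V} := (c \*: F h1) \+ F h2.
rewrite -[LHS]/(F (c *: h1 + h2) g) -[RHS]/(H g); apply: linear_eq => a.
by rewrite /= /F !fextE linearP.
Qed.

HB.instance Definition _ g := GRing.isLinear.Build k V V *:%R (twist g) (twist_linearr g).

Lemma twist_linearl h : linear (twist^~ h).
Proof. by move=> c g1 g2; rewrite /twist linearP. Qed.

Local Notation F := (freealg k nu).
Definition fword (m : {fmonom 'I_nu}) : F := << m >>.

Lemma fwordM m n : fword m * fword n = fword (mmul m n).
Proof. by rewrite [LHS]malgM_def fgmulUU mulr1. Qed.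

Lemma freealgE (f : F) : f = \sum_(m <- msupp f) (f@_m : k) *: fword m.
Proof.
rewrite {1}[f]monalgE; apply: eq_bigr => m _.
by apply/malgP => v; rewrite mcoeffZ !mcoeffU mulr_natr.
Qed.

Lemma freealg_linear_eq (W : lmodType k) (f h : {linear F -> W}) :
  (forall m, f (fword m) = h (fword m)) -> f =1 h.
Proof.
move=> fh g; rewrite [g]freealgE !linear_sum; apply: eq_bigr => m _.
by rewrite !linearZ_LR fh.
Qed.

(** The coordinates on the ordered monomials, first on the free algebra. They are
multiplicative for twist and kill the relations, hence pass to the quotient; so
the ordered monomials are linearly independent. *)
Definition fcoord : {linear F -> V} :=
  lext (fun m : {fmonom 'I_nu} => kappa m *: bV (degw m)).

Lemma fcoordE (m : {fmonom 'I_nu}) : fcoord (fword m) = kappa m *: bV (degw m).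
Proof. exact: lextU. Qed.

Lemma twistZ a b (c c' : k) : twist (c *: bV a) (c' *: bV b) =
  (c * c' * coc a b) *: bV (a + b).
Proof.
have -> : twist (c *: bV a) (c' *: bV b) = c *: twist (bV a) (c' *: bV b).
  by rewrite /twist linearZ.
by rewrite linearZ /= twist_fb !scalerA.
Qed.

Lemma fcoordM f g : fcoord (f * g) = twist (fcoord f) (fcoord g).
Proof.
apply: (bilinear_mult (fw := fword) twist_linearr twist_linearl) => [h|m n].
  by exists (msupp h), (fun m => h@_m); exact: freealgE.
by rewrite fwordM !fcoordE twistZ fmM kappa_cat degw_cat.
Qed.

Lemma kappa_swap i j : kappa [:: j; i] = Lambda i j * kappa [:: i; j].
Proof.
have low_unit p q : lowc (unitd p) q = if (p < q)%N then Lambda p q else 1.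
  rewrite /lowc; case: ifP => pq.
    rewrite (bigD1 p) //= ffunE eqxx expr1 big1 ?mulr1 // => l /andP [_ /negPf lp].
    by rewrite ffunE lp.
  apply: big1 => l lq; rewrite ffunE; case: eqVneq => // lp.
  by rewrite -lp lq in pq.
rewrite /= !degw_cons !degw_nil !addr0 !lowc0 !mulr1 !low_unit.
case: (ltngtP i j) => [ij|ji|/val_inj ->]; rewrite ?mulr1 //.
by have := Lambda_inv ji; rewrite mulrC => ->.
Qed.

Lemma fcoord_ideal f : f \in ideal_pred (aff_rel Lambda) -> fcoord f = 0.
Proof.
move=> /span_predP; elim=> [z | | c y z _ hy _ hz].
- case=> a [r [b [[i [j ->]] ->]]]; rewrite fcoordM fcoordM.
  suff -> : fcoord (freegen k j * freegen k i -
                    Lambda i j *: (freegen k i * freegen k j)) = 0.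
    by rewrite linear0 /= /twist linear0.
  have -> l : freegen k l = fword (fmu l) by [].
  rewrite !fwordM linearB linearZ_LR !fcoordE !fmM !fmU !cat1s kappa_swap.
  by rewrite scalerA !degw_cons addrCA subrr.
- exact: linear0.
- by rewrite linearP hy hz scaler0 addr0.
Qed.

Local Notation A := (affine_space Lambda).
Local Notation pi := (qapi (aff_proper Lambda)).

Definition acoord (z : A) : V := fcoord (qrepr z).

Lemma coord_pi f : acoord (pi f) = fcoord f.
Proof.
apply/eqP; rewrite -subr_eq0 -linearB; apply/eqP/fcoord_ideal.
by rewrite -(qapi_eq (aff_proper Lambda)) qapi_repr.
Qed.

Lemma coord_linear : linear acoord.
Proof.
move=> c y z; rewrite -[y]qapi_repr -[z]qapi_repr -linearP !coord_pi.
exact: linearP.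
Qed.

HB.instance Definition _ := GRing.isLinear.Build k A V *:%R acoord coord_linear.

Definition affine_coord : {linear A -> V} := acoord.

Lemma pi_fword m : pi (fword m) = \prod_(i <- m) aff_gen Lambda i.
Proof.
case: m => m; elim: m => [|i m IH]; first by rewrite big_nil -fmoneE.
rewrite big_cons -IH -qapiM; congr (pi _).
by rewrite [RHS]fwordM; congr fword; rewrite fmuE; apply/eqP; rewrite fmP fmM.
Qed.

Definition amon : mdegree -> A := mon (aff_gen Lambda).

Lemma coord_amon a : acoord (amon a) = bV a.
Proof.
have [m <-] := degw_surj a.
apply: (scalerI (kappa_neq0 m)); rewrite -linearZ_LR.
rewrite -(wordE (@aff_gen_rel k nu Lambda)).
rewrite -[m]/(val (FMonom m)) -pi_fword.
by rewrite -[LHS]/(acoord _) coord_pi fcoordE.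
Qed.

Lemma amon_coord z : fext amon (acoord z) = z.
Proof.
pose h : {linear F -> A} := pi.
have e : fext amon \o fcoord =1 h.
  apply: freealg_linear_eq => m.
  rewrite /h /= fcoordE linearZ_LR fextE pi_fword.
  by rewrite (wordE (@aff_gen_rel k nu Lambda)).
by rewrite [LHS]e; exact: qapi_repr.
Qed.

End AffineBasis.

(** * Coordinates on tensor powers *)
Section TensorBasis.
Variables (k : fieldType) (A : lmodType k).

Lemma upd_id m (f : {ffun 'I_m -> A}) j : upd f j (f j) = f.
Proof. by apply/ffunP => l; rewrite ffunE; case: eqP => [->|]. Qed.

Lemma tensor_upd0 m (f : {ffun 'I_m -> A}) j : tensor (upd f j 0) = 0.
Proof.
have := tensor_multilinear f j (-1) 0 0.
by rewrite scaler0 addr0 scaleN1r addNr.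
Qed.

Lemma tensor_updZ m (f : {ffun 'I_m -> A}) j c y :
  tensor (upd f j (c *: y)) = c *: tensor (upd f j y).
Proof. by rewrite -[c *: y]addr0 tensor_multilinear tensor_upd0 addr0. Qed.

Lemma tensor_scale m (f g : {ffun 'I_m -> A}) j c :
  (forall l, g l = (if l == j then c else 1) *: f l) -> tensor g = c *: tensor f.
Proof.
move=> gf; have -> : g = upd f j (c *: f j).
  apply/ffunP => l; rewrite gf ffunE; case: eqP => [->//|_].
  by rewrite scale1r.
by rewrite tensor_updZ upd_id.
Qed.

Lemma tensor_upd_sum m (f : {ffun 'I_m -> A}) j (I : Type) (r : seq I) (c : I -> k)
    (y : I -> A) :
  tensor (upd f j (\sum_(i <- r) c i *: y i)) =
  \sum_(i <- r) c i *: tensor (upd f j (y i)).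
Proof.
elim: r => [|i r IH]; first by rewrite !big_nil tensor_upd0.
by rewrite !big_cons tensor_multilinear IH.
Qed.

Variables (K : choiceType) (mon : K -> A) (crd : {linear A -> fmod k K}).
Hypothesis crd_mon : forall a, crd (mon a) = fb k a.
Hypothesis mon_crd : forall z, fext mon (crd z) = z.

Lemma mon_span z : z = \sum_(a <- fsupp (crd z)) fcoef a (crd z) *: mon a.
Proof.
rewrite -{1}[z]mon_crd {1}[crd z]fmodE linear_sum; apply: eq_bigr => a _.
by rewrite linearZ_LR fextE.
Qed.

(** Multilinear expansion, one tensor factor at a time. *)
Lemma tpow_basis_ind m (P : tpow A m -> Prop) :
    P 0 -> (forall c y z, P y -> P z -> P (c *: y + z)) ->
    (forall u : 'I_m -> K, P (tensor [ffun j => mon (u j)])) ->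
  forall z, P z.
Proof.
move=> P0 PL Pu z.
have Psum (I : Type) (r : seq I) (c : I -> k) (y : I -> tpow A m) :
    (forall i, P (y i)) -> P (\sum_(i <- r) c i *: y i).
  by move=> Py; elim: r => [|i r IH]; rewrite ?big_nil // big_cons; apply: PL.
suff Pt (s : seq 'I_m) (a : {ffun 'I_m -> A}) :
    (forall j, j \notin s -> exists c, a j = mon c) -> P (tensor a).
  have [g ->] := tensor_span z; apply: Psum => a.
  by apply: (Pt (enum 'I_m)) => j; rewrite mem_enum.
elim: s a => [|i s IH] a am.
  have {}am j : exists c, a j = mon c by apply: am.
  rewrite (_ : a = [ffun j => mon (sval (cid (am j)))]); first exact: Pu.
  by apply/ffunP => j; rewrite ffunE; exact: svalP (cid (am j)).
rewrite -(upd_id a i) (mon_span (a i)) tensor_upd_sum; apply: Psum => c.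
apply: IH => j js; rewrite ffunE; case: eqP => [_|/eqP ji]; first by exists c.
by apply: am; rewrite inE negb_or ji.
Qed.

Local Notation W := (fmod k (seq K)).

Definition push (a : K) : {linear W -> W} := fext (fun w => fb k (a :: w)).
(** Prepending a vector z, expanded on the basis, to a combination of words. *)
Definition pushv (z : A) (g : W) : W := fext (fun a => push a g) (crd z).

Lemma pushv_linearl g : linear (pushv^~ g).
Proof. by move=> c y z; rewrite /pushv !linearP. Qed.

Lemma pushv_linearr z : linear (pushv z).
Proof.
move=> c g h; rewrite /pushv.
pose E g : {linear fmod k K -> W} := fext (fun a => push a g).
pose H : {linear fmod k K -> W} := (c \*: E g) \+ E h.
rewrite -[LHS]/(E (c *: g + h) (crd z)) -[RHS]/(H (crd z)); apply: linear_eq => a.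
by rewrite /= /E !fextE linearP.
Qed.

Fixpoint words m (f : {ffun 'I_m -> A}) (s : seq 'I_m) : W :=
  if s is j :: s' then pushv (f j) (words f s') else fb k [::].

Lemma words_notin m (f : {ffun 'I_m -> A}) s i z :
  i \notin s -> words (upd f i z) s = words f s.
Proof.
elim: s => //= j s IH; rewrite inE negb_or eq_sym => /andP [/negPf ji /IH ->].
by rewrite ffunE ji.
Qed.

Lemma words_multilinear m : multilinear (fun f : {ffun 'I_m -> A} => words f (enum 'I_m)).
Proof.
move=> f i c y z; have := mem_enum 'I_m i; have := enum_uniq 'I_m.
elim: (enum _) => //= j s IH /andP [js us].
rewrite inE eq_sym !ffunE; case: eqVneq => [e _|ji] /=.
  by rewrite e in js *; rewrite !words_notin //; exact: pushv_linearl.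
by move=> i_s; rewrite IH //; exact: pushv_linearr.
Qed.

Definition tcoord m : tpow A m -> W :=
  tlift (fun f : {ffun 'I_m -> A} => words f (enum 'I_m)).

Lemma tcoord_linear m : linear (@tcoord m).
Proof. exact: tlift_linear (@words_multilinear m). Qed.

HB.instance Definition _ m := GRing.isLinear.Build k (tpow A m) W *:%R
  (@tcoord m) (@tcoord_linear m).

Lemma tcoord_mon m (u : 'I_m -> K) :
  tcoord (tensor [ffun j => mon (u j)]) = fb k (map u (enum 'I_m)).
Proof.
rewrite /tcoord (tlift_tensor (@words_multilinear m)).
elim: (enum _) => //= j s ->.
by rewrite ffunE /pushv crd_mon !fextE.
Qed.

End TensorBasis.

(** * Hochschild chains as words *)
Section Faces.
Variables (k : fieldType) (nu : nat).
Local Notation mdegree := {ffun 'I_nu -> nat}.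
Implicit Types (a b d : mdegree) (w v : seq mdegree) (i j : 'I_nu)
  (t : 'I_nu -> k).
Local Notation G := (fmod k (seq mdegree)).
Local Notation bw := (@fb k (seq mdegree)).

Lemma tailw_size t w : tailw t w \in supp_in (fun v => (size v).+1 == size w).
Proof.
elim: w => [|a [|b w] IH]; first exact: rpred0.
  by rewrite tailw1 rpredZ // supp_in_basis.
rewrite tailw2 rpredB ?supp_in_basis //.
by apply: consl_supp IH => v.
Qed.

Lemma bdry_size t w : bdry t (bw w) \in supp_in (fun v => (size v).+1 == size w).
Proof.
rewrite bdryE; case: w => [|a w]; first exact: rpred0.
by rewrite rpredB ?supp_in_basis ?tailw_size.
Qed.

Fixpoint merge_at (p : nat) w : seq mdegree :=
  match p, w with
  | 0, a :: b :: w' => (a + b) :: w'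
  | p'.+1, a :: w' => a :: merge_at p' w'
  | _, _ => w
  end.

(** Closed form of tailw, indexed as the faces of the Hochschild complex. *)
Lemma tailw_sum t b w : tailw t (b :: w) =
  \sum_(p < size w) (-1) ^+ p *: bw (merge_at p (b :: w)) +
  ((-1) ^+ size w * dchar t (last b w)) *: bw (belast b w).
Proof.
elim: w b => [|c w IH] b; first by rewrite tailw1 big_ord0 add0r expr0 mul1r.
rewrite tailw2 big_ord_recl /= expr0 scale1r -addrA; congr (_ + _).
rewrite IH linearD linear_sum opprD; congr (_ + _).
  rewrite -sumrN; apply: eq_bigr => p _.
  by rewrite linearZ /= consl1 exprS mulN1r scaleNr.
by rewrite linearZ /= consl1 exprS mulN1r !mulNr scaleNr.
Qed.

Lemma wsum_merge_at p w : wsum (merge_at p w) = wsum w.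
Proof.
elim: p w => [|p IH] [|a w] //=; last by rewrite !wsum_cons IH.
by case: w => // b w; rewrite !wsum_cons addrA.
Qed.

Lemma size_merge_at p w : (p.+1 < size w)%N -> size (merge_at p w) = (size w).-1.
Proof. by elim: p w => [|p IH] [|a [|b w]] //= pw; rewrite IH. Qed.

Lemma nth_merge_at p w q : (p.+1 < size w)%N -> nth 0 (merge_at p w) q =
  if (q < p)%N then nth 0 w q
  else if q == p then nth 0 w p + nth 0 w p.+1 else nth 0 w q.+1.
Proof.
elim: p w q => [|p IH] [|a [|b w]] [|q] //= pw.
by rewrite IH //= ltnS eqSS.
Qed.

End Faces.

Section Transport.
Variables (k : fieldType) (nu : nat) (Lambda : 'M[k]_nu).
Hypothesis Lambda_neq0 : forall i j, Lambda i j != 0.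
Local Notation mdegree := {ffun 'I_nu -> nat}.
Implicit Types (a b d : mdegree) (u w v : seq mdegree).
Local Notation G := (fmod k (seq mdegree)).
Local Notation bw := (@fb k (seq mdegree)).
Local Notation coc := (coc Lambda).
Variables (A : algType k) (mon : mdegree -> A) (crd : {linear A -> fmod k mdegree}).
Hypothesis crd_mon : forall a, crd (mon a) = fb k a.
Hypothesis mon_crd : forall z, fext mon (crd z) = z.
Hypothesis mon_mul : forall a b, mon a * mon b = coc a b *: mon (a + b).

(** The character of the cyclic face in degree d, by its values at the generators. *)
Definition psi d i := lowc Lambda d i / highc Lambda d i.

Lemma dchar_psi d a : dchar (psi d) a = coc a d / coc d a.
Proof.
rewrite [coc d a]coc_highc /coc /dchar -prodf_div; apply: eq_bigr => i _.
by rewrite /psi expr_div_n.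
Qed.

(** The scalar lam u with x^(a_0) ... x^(a_n) = lam u x^d for u = (a_0, ..., a_n)
of sum d. Dividing by it makes the merging faces free of scalars. *)
Fixpoint lam u : k := if u is a :: w then coc a (wsum w) * lam w else 1.

Lemma lam_cons a w : lam (a :: w) = coc a (wsum w) * lam w.
Proof. by []. Qed.
Arguments lam : simpl never.

Lemma lam_neq0 u : lam u != 0.
Proof.
elim: u => [|a w IH]; first exact: oner_neq0.
by rewrite lam_cons mulf_neq0 ?coc_neq0.
Qed.

Lemma lam_merge_at p u : (p.+1 < size u)%N ->
  lam u = coc (nth 0 u p) (nth 0 u p.+1) * lam (merge_at p u).
Proof.
elim: p u => [|p IH] [|a [|b w]] //= pu.
  by rewrite !lam_cons wsum_cons cocDr cocDl; ring.
by rewrite !lam_cons -lam_cons IH //= wsum_merge_at; ring.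
Qed.

Lemma wsum_rcons u a : wsum (rcons u a) = wsum u + a.
Proof. by rewrite /wsum -cats1 big_cat big_seq1. Qed.

Lemma lam_quot p u : (p.+1 < size u)%N ->
  (lam u)^-1 * coc (nth 0 u p) (nth 0 u p.+1) = (lam (merge_at p u))^-1.
Proof.
move=> /lam_merge_at ->.
by rewrite invfM mulrAC mulVf ?mul1r ?coc_neq0.
Qed.

Lemma lam_rcons u a : lam (rcons u a) = lam u * coc (wsum u) a.
Proof.
elim: u => [|b u IH] /=; first by rewrite lam_cons wsum_nil coc0r coc0l.
by rewrite !lam_cons IH wsum_cons wsum_rcons cocDr cocDl; ring.
Qed.

(** Moving the last letter b to the front multiplies the product of the monomials
by psi at b, because coc b b cancels. *)
Lemma lam_cyclic a b v (d := wsum (a :: rcons v b)) :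
  lam (a :: rcons v b) * dchar (psi d) b = coc b a * lam ((b + a) :: v).
Proof.
rewrite dchar_psi /d wsum_cons !lam_cons lam_rcons wsum_rcons.
have h1 := coc_neq0 Lambda_neq0 a b.
have h2 := coc_neq0 Lambda_neq0 (wsum v) b.
have h3 := coc_neq0 Lambda_neq0 b b.
rewrite !cocDr !cocDl; field.
by rewrite h1 h2 h3.
Qed.

Definition btensor n u : hchain A n :=
  tensor [ffun j : 'I_n.+1 => mon (nth 0 u j)].

Lemma hface_inner n u (p : 'I_n.+2) : size u = n.+2 -> (p < n.+1)%N ->
  tensor (hface [ffun j : 'I_n.+2 => mon (nth 0 u j)] p) =
  coc (nth 0 u p) (nth 0 u p.+1) *: btensor n (merge_at p u).
Proof.
move=> su pn; apply: (tensor_scale (j := inord p)) => l.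
rewrite !ffunE nth_merge_at ?su // -!val_eqE /= inordK // /bump /= add1n.
rewrite (ltn_eqF pn); case: ltnP => [lp|pl].
  by rewrite (ltn_eqF lp) scale1r.
by case: eqP => [->|_]; rewrite ?mon_mul ?scale1r.
Qed.

Lemma hface_last n a b v : size v = n ->
  tensor (hface [ffun j : 'I_n.+2 => mon (nth 0 (a :: rcons v b) j)] ord_max) =
  coc b a *: btensor n ((b + a) :: v).
Proof.
move=> sv; apply: (tensor_scale (j := ord0)) => l.
have nb : nth 0 (rcons v b) n = b by rewrite nth_rcons sv ltnn eqxx.
rewrite !ffunE eqxx -!val_eqE /= nb.
case: eqP => [->|/eqP l0] /=; first by rewrite mon_mul.
rewrite scale1r; case: l l0 => -[|l] //= ln _.
by rewrite nth_rcons sv; case: ltnP => // nl; exfalso; lia.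
Qed.

(** The normalised chain with the letters w in positions 1 to n, the letter in
position 0 completing the degree to d. Words of any other length go to 0, so that
theta d n also picks the part of length n of a combination of words. *)
Definition thetaw d n w : hchain A n :=
  if size w == n then
    (lam (subd d (wsum w) :: w))^-1 *: btensor n (subd d (wsum w) :: w)
  else 0.

Definition theta d n : {linear G -> hchain A n} := fext (thetaw d n).

Lemma thetaE d n w : theta d n (bw w) = thetaw d n w.
Proof. exact: fextE. Qed.

Lemma subdK d a : mle a d -> subd d a + a = d.
Proof. by move=> /mleP ad; apply/ffunP => i; rewrite addd ffunE subnK. Qed.

Lemma addK a b : subd (a + b) b = a.
Proof. by apply/ffunP => i; rewrite ffunE addd addnK. Qed.

Lemma theta_addE d n a w : d = a + wsum w -> size w = n ->
  theta d n (bw w) = (lam (a :: w))^-1 *: btensor n (a :: w).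
Proof. by move=> -> sw; rewrite thetaE /thetaw sw eqxx addK. Qed.

(** The degree d part of the Hochschild complex is the word complex of psi d. *)
Lemma hbdry_theta d n g : g \in below d ->
  hbdry (theta d n.+1 g) = theta d n (bdry (psi d) g).
Proof.
move=> gd; pose f : {linear G -> hchain A n} := @hbdry k A n \o theta d n.+1.
pose h : {linear G -> hchain A n} := theta d n \o bdry (psi d).
rewrite -[LHS]/(f g) -[RHS]/(h g); apply: (linear_eq_on gd) => w wd.
rewrite /f /h /=; case: (eqVneq (size w) n.+1) => [sw|sw]; last first.
  rewrite thetaE /thetaw (negPf sw) linear0.
  pose z : {linear G -> hchain A n} := \0.
  apply/esym/(linear_eq_on (h := z) (bdry_size _ _)) => v sv.
  by rewrite thetaE /thetaw /=; case: eqP => // e; rewrite -(eqP sv) e eqxx in sw.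
case: w wd sw => [|b w] wd // [sw]; set a := subd d (wsum (b :: w)).
have dE : d = a + wsum (b :: w) by rewrite subdK.
rewrite (theta_addE dE) /= ?sw // linearZ /= hbdry_tensor scaler_sumr.
rewrite bdryE /= tailw_sum big_ord_recl big_ord_recr /= linearB linearD linear_sum /=.
rewrite opprD; subst n; congr (_ + (_ + _)).
(* The face of index 0, the inner faces, then the cyclic face. *)
- rewrite expr0 scale1r hface_inner //=.
  rewrite (theta_addE (a := a + b)) //; last by rewrite dE wsum_cons addrA.
  by rewrite scalerA (lam_quot (p := 0%N) (u := [:: a, b & w])).
- rewrite -sumrN; apply: eq_bigr => p _.
  have pw : (p.+2 < size [:: a, b & w])%N by rewrite /= !ltnS.
  rewrite hface_inner // [theta d _ _](linearZ_LR (theta d _)).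
  rewrite (theta_addE (a := a)) ?wsum_merge_at ?size_merge_at //.
  rewrite lift0 [nat_of_ord (widen_ord _ _)]/= -[bump 0 p]/(nat_of_ord (lift ord0 p)) lift0.
  rewrite !scalerA mulrAC (lam_quot pw) exprS mulN1r mulrN scaleNr.
  by rewrite mulrC.
rewrite [theta d _ _](linearZ_LR (theta d _)).
have -> : lift ord0 ord_max = ord_max :> 'I_(size w).+2 by apply: val_inj.
rewrite [b :: w]lastI in dE *.
have sb : size (belast b w) = size w by rewrite size_belast.
rewrite (hface_last _ _ sb) (theta_addE (a := last b w + a)) //; last first.
  by rewrite dE wsum_rcons -addrA [RHS]addrC addrA.
rewrite !scalerA -scaleNr; congr (_ *: _).
have e : lam (a :: rcons (belast b w) (last b w)) * dchar (psi d) (last b w) =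
    coc (last b w) a * lam ((last b w + a) :: belast b w).
  by rewrite dE -wsum_cons lam_cyclic.
have h1 := lam_neq0 (a :: rcons (belast b w) (last b w)).
have h2 := lam_neq0 ((last b w + a) :: belast b w).
rewrite -(mulKf h1 (dchar _ _)) e /bump add1n exprS.
move: (lam _) (lam _) h1 h2 => x y x0 y0; field.
by rewrite x0 y0.
Qed.

Local Notation tcoord := (@tcoord k A mdegree crd _).

Lemma tcoord_btensor n u : size u = n.+1 -> tcoord (btensor n u) = bw u.
Proof.
move=> su; rewrite /btensor (tcoord_mon crd_mon (fun j => nth 0 u j)); congr fb.
apply: (@eq_from_nth _ 0) => [|l]; first by rewrite size_map size_enum_ord.
rewrite size_map => lu; rewrite (nth_map ord0) //.
by rewrite nth_enum_ord // -[X in (_ < X)%N]size_enum_ord.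
Qed.

Lemma btensor_ind n (P : hchain A n -> Prop) :
    P 0 -> (forall c y z, P y -> P z -> P (c *: y + z)) ->
    (forall a w, size w = n -> P (btensor n (a :: w))) ->
  forall z, P z.
Proof.
move=> P0 PL Pb; apply: (tpow_basis_ind mon_crd P0 PL) => u.
pose s := map u (enum 'I_n.+1).
have ss : size s = n.+1 by rewrite size_map size_enum_ord.
suff -> : tensor [ffun j => mon (u j)] = btensor n s :> hchain A n.
  by case: (s) ss => // a w [sw]; apply: Pb.
congr tensor; apply/ffunP => j; rewrite !ffunE; congr mon.
by rewrite (nth_map ord0) ?size_enum_ord // nth_ord_enum.
Qed.

(** Composed with tcoord, a left inverse of theta d: keeps the words of total degree d,
drops their first letter and undoes the normalisation. *)
Definition wproj d : {linear G -> G} :=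
  fext (fun u => if wsum u == d then lam u *: bw (behead u) else 0).

Definition homog d n (z : hchain A n) : G := wproj d (tcoord z).

Lemma homog_linear d n : linear (@homog d n).
Proof. by move=> c y z; rewrite /homog !linearP. Qed.

HB.instance Definition _ d n := GRing.isLinear.Build k (hchain A n) G *:%R
  (@homog d n) (@homog_linear d n).

Lemma homog_btensor d n a w : size w = n ->
  homog d (btensor n (a :: w)) =
  if a + wsum w == d then lam (a :: w) *: bw w else 0.
Proof.
move=> sw; rewrite /homog tcoord_btensor /= ?sw // /wproj fextE wsum_cons.
by [].
Qed.

Definition hword d n w := (size w == n) && mle (wsum w) d.

Lemma homog_supp d n z : @homog d n z \in supp_in (hword d n).
Proof.
elim/btensor_ind: z => [|c y z hy hz|a w sw].
- by rewrite linear0 rpred0.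
- by rewrite linearP rpredD // rpredZ.
rewrite homog_btensor //; case: eqP => [<-|_]; last exact: rpred0.
by rewrite rpredZ // supp_in_basis // /hword sw eqxx mle_addl.
Qed.

Lemma homog_theta d d' n g : g \in supp_in (hword d n) ->
  homog d' (theta d n g) = if d == d' then g else 0.
Proof.
move=> gd; pose f : {linear G -> G} := @homog d' n \o theta d n.
pose h : {linear G -> G} := ((d == d')%:R : k) \*: idfun.
have -> : (if d == d' then g else 0) = h g.
  by rewrite /h /=; case: ifP; rewrite ?scale1r ?scale0r.
rewrite -[LHS]/(f g); apply: (linear_eq_on gd) => w /andP [/eqP sw wd].
have dE : d = subd d (wsum w) + wsum w by rewrite subdK.
rewrite /f /h /= (theta_addE dE sw) linearZ /= homog_btensor // -dE.
case: eqP => _ /=; first by rewrite scalerA mulVf ?scale1r ?lam_neq0.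
by rewrite scaler0 scale0r.
Qed.

Lemma homog_sum n (z : hchain A n) : exists ds0 : seq mdegree,
  forall ds, uniq ds -> {subset ds0 <= ds} ->
    z = \sum_(d <- ds) theta d n (homog d z).
Proof.
elim/btensor_ind: z => [|c y z [dy hy] [dz hz]|a w sw].
- exists [::] => ds _ _; rewrite big1 // => d _.
  by rewrite [homog _ _]linear0 linear0.
- exists (dy ++ dz) => ds dsU sub.
  rewrite {1}(hy ds dsU); last by move=> d dd; apply: sub; rewrite mem_cat dd.
  rewrite {1}(hz ds dsU); last by move=> d dd; apply: sub; rewrite mem_cat dd orbT.
  rewrite scaler_sumr -big_split; apply: eq_bigr => d _.
  by rewrite [homog _ (_ + _)]linearP linearP.
exists [:: a + wsum w] => ds dsU sub.
have ads : a + wsum w \in ds by apply: sub; rewrite inE.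
rewrite (bigD1_seq _ ads dsU) /= big1 => [|d /negPf ad]; last first.
  by rewrite homog_btensor // eq_sym ad linear0.
rewrite homog_btensor // eqxx linearZ /= (theta_addE (a := a)) //.
by rewrite scalerA mulfV ?lam_neq0 // scale1r addr0.
Qed.

(** The boundary of z is the sum of the images under theta of the word boundaries
of its parts, and homog d selects the one of degree d. *)
Lemma homog_cycle d n (z : hchain A n) : z \in @hcycle_pred k A n ->
  bdry (psi d) (homog d z) = 0.
Proof.
pose zero : {linear G -> G} := \0; case: n z => [|n] z.
  move=> _; apply: (linear_eq_on (h := zero) (homog_supp d z)) => w.
  by case/andP; case: w => // _ _; rewrite bdryE.
rewrite unfold_in => /eqP bz; have [ds0 zE] := homog_sum z.
pose ds := undup (d :: ds0).
have /zE e : uniq ds by exact: undup_uniq.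
have {}e := e _; move: bz; rewrite {1}e; last first.
  by move=> d' dd; rewrite mem_undup inE dd orbT.
rewrite linear_sum => /(congr1 (@homog d n)).
rewrite linear0 linear_sum (bigD1_seq d) ?undup_uniq //=; last first.
  by rewrite mem_undup inE eqxx.
have below_h d' : homog d' z \in below d'.
  by apply: supp_inW (homog_supp d' z) => w /andP [].
have bdry_h d' : bdry (psi d') (homog d' z) \in supp_in (hword d' n).
  apply: (linear_mem (homog_supp d' z)) => w /andP [/eqP sw wd].
  have /supp_inP h1 := bdry_size (psi d') w.
  have /supp_inP h2 : bdry (psi d') (bw w) \in below d'.
    by apply/bdry_below/supp_in_basis.
  apply/supp_inP => v v0; rewrite /hword h2 // andbT.
  by have := h1 _ v0; rewrite sw eqSS.
rewrite hbdry_theta // homog_theta // eqxx big1 ?addr0 // => d' /negPf dd.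
by rewrite hbdry_theta // homog_theta // dd.
Qed.

End Transport.

Arguments lam : simpl never.

(** * Isomorphisms onto Hochschild homology *)
Lemma linear_map0 (k : fieldType) (U V : lmodType k) (f : U -> V) :
  linear f -> f 0 = 0.
Proof. by move=> fL; have := fL (-1) 0 0; rewrite scaler0 addr0 scaleN1r addNr. Qed.

Section HomologyClasses.
Variables (k : fieldType) (A : algType k).

Lemma bdry_vanish n (V : lmodType k) (phi : {linear hchain A n -> V}) :
  (forall a : {ffun 'I_n.+2 -> A}, phi (hbdry (tensor a)) = 0) ->
  forall y, phi (hbdry y) = 0.
Proof.
move=> probe0 y; have [g ->] := tensor_span y.
rewrite (linear_sum (@hbdry k A n)) linear_sum big1 // => a _.
by rewrite (linearZ_LR (@hbdry k A n)) linearZ_LR probe0 scaler0.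
Qed.

Lemma hclass_eq0 n (z : hcycle A n) :
  hclass A n z = 0 <-> exists y, val z = hbdry y.
Proof.
have e : (hclass A n z == 0) = (z \in @hbound_pred k A n).
  by rewrite -[X in _ == X](linear0 (hclass A n)) qpi_eq subr0.
by split=> [/eqP|zb]; [rewrite e => /asboolP|apply/eqP; rewrite e; apply/asboolP].
Qed.

Lemma HH_iso_of n (V : lmodType k) (t : V -> hchain A n) :
    linear t -> (forall u, t u \in @hcycle_pred k A n) ->
    (forall u y, t u = hbdry y -> u = 0) ->
    (forall z, z \in @hcycle_pred k A n -> exists u y, z = t u + hbdry y) ->
  HH_iso_by t.
Proof.
move=> tL tc inj surj.
pose s u : hcycle A n := HCycle (tc u).
have sL : linear s by move=> c y z; apply: val_inj; rewrite linearP /= tL.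
pose sl : {linear V -> hcycle A n} := HB.pack s
  (GRing.isLinear.Build _ _ _ _ s sL).
exists (hclass A n \o sl : {linear V -> HH A n}); last first.
  by move=> u; exists (s u).
have f_inj : injective (hclass A n \o sl).
  move=> u v uv; apply/eqP; rewrite -subr_eq0; apply/eqP.
  have : hclass A n (sl (u - v)) = 0.
    by rewrite linearB linearB; apply/eqP; rewrite subr_eq0; apply/eqP.
  by case/hclass_eq0 => y /= /inj.
have f_surj h : exists u, (hclass A n \o sl) u = h.
  have [z <-] := qpi_surj h; have [u [y zE]] := surj (val z) (valP z).
  exists u; apply/eqP; rewrite eq_sym -subr_eq0 /= -linearB; apply/eqP/hclass_eq0.
  by exists y; rewrite linearB /= zE addrC addKr.
exists (fun h => sval (cid (f_surj h))) => [u|h]; last exact: svalP (cid (f_surj h)).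
by apply: f_inj; exact: svalP (cid (f_surj _)).
Qed.

Lemma HH_eq0 n (h : HH A n) :
  (forall z, z \in @hcycle_pred k A n -> exists y, z = hbdry y) -> h = 0.
Proof.
move=> exact_n; have [z <-] := qpi_surj h; apply/hclass_eq0.
exact: exact_n (valP z).
Qed.

End HomologyClasses.

(** * Homology in each degree *)
Section Homology.
Variables (k : fieldType) (nu : nat) (Lambda : 'M[k]_nu).
Hypothesis nu_gt0 : (0 < nu)%N.
Hypothesis Lambda_neq0 : forall i j, Lambda i j != 0.
Local Notation mdegree := {ffun 'I_nu -> nat}.
Implicit Types (a b d : mdegree) (w : seq mdegree) (i j : 'I_nu).
Local Notation G := (fmod k (seq mdegree)).
Local Notation bw := (@fb k (seq mdegree)).
Variables (A : algType k) (x : 'I_nu -> A).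
Hypothesis x_rel : forall i j, x j * x i = Lambda i j *: (x i * x j).
Local Notation mon := (mon x).
Variable crd : {linear A -> fmod k mdegree}.
Hypothesis crd_mon : forall a, crd (mon a) = fb k a.
Hypothesis mon_crd : forall z, fext mon (crd z) = z.
Hypothesis psi_neq1 : forall d i j, i != j -> (0 < d i)%N -> (0 < d j)%N ->
  psi Lambda d i != 1.

Let mon_mul := monM Lambda_neq0 x_rel.
Local Notation theta := (theta Lambda mon).
Local Notation homog := (homog Lambda crd).

Lemma degree_cases d : (exists i m, d = unitd i *+ m) \/
  (exists i j, [/\ i != j, (0 < d i)%N & (0 < d j)%N]).
Proof.
have [[i di]|d0] := pselect (exists i, (0 < d i)%N); last first.
  left; exists (Ordinal nu_gt0), 0%N; apply/ffunP => j; rewrite mulr0n zerod.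
  by apply/eqP; rewrite -leqn0 leqNgt; apply/negP => dj; apply: d0; exists j.
have [[j [ij dj]]|d0] := pselect (exists j, i != j /\ (0 < d j)%N).
  by right; exists i, j.
left; exists i, (d i); apply/ffunP => j; rewrite mulnd ffunE.
case: eqVneq => [->|ji]; first by rewrite mul1n.
rewrite mul0n; apply/eqP; rewrite -leqn0 leqNgt; apply/negP => dj.
by apply: d0; exists j; rewrite eq_sym.
Qed.

Lemma psi_power i m : psi Lambda (unitd i *+ m) i = 1.
Proof.
have e j : j != i -> (unitd i *+ m : mdegree) j = 0%N.
  by move=> /negPf ji; rewrite mulnd ffunE ji.
rewrite /psi /lowc /highc !big1 ?invr1 ?mulr1 // => j ij; rewrite e ?expr0 //.
  by apply: contraTneq ij => ->; rewrite ltnn.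
by apply: contraTneq ij => ->; rewrite ltnn.
Qed.

(** Every homogeneous part of a cycle is a boundary, except in the degrees
m e_i, where the empty word and the word (e_i) may remain. *)
Lemma cycle_ind n (P : hchain A n -> Prop) :
    P 0 -> (forall c y z, P y -> P z -> P (c *: y + z)) ->
    (forall y, P (hbdry y)) ->
    (forall i m, P (theta (unitd i *+ m) n (bw [::]))) ->
    (forall i m, P (theta (unitd i *+ m) n (bw [:: unitd i]))) ->
  forall z, z \in @hcycle_pred k A n -> P z.
Proof.
move=> P0 PL Pb P1 P2 z zc.
have PD y y' : P y -> P y' -> P (y + y').
  by move=> py py'; rewrite -[y]scale1r; apply: PL.
have PZ c y : P y -> P (c *: y) by move=> py; rewrite -[_ *: _]addr0; apply: PL.
have [ds0 zE] := homog_sum Lambda_neq0 crd_mon mon_crd z.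
rewrite {}(zE (undup ds0)) ?undup_uniq //; last first.
  by move=> d; rewrite mem_undup.
elim: (undup _) => [|d ds IH]; first by rewrite big_nil.
rewrite big_cons; apply: (PD _ _ _ IH) => {ds IH}.
have hb : homog d z \in below d.
  by apply: supp_inW (homog_supp Lambda crd_mon mon_crd d z) => w /andP [].
have hc := homog_cycle Lambda_neq0 crd_mon mon_crd mon_mul d zc.
have thetaB g : g \in below d -> theta d n (bdry (psi Lambda d) g) = hbdry (theta d n.+1 g).
  by move=> gd; apply/esym; exact: (hbdry_theta Lambda_neq0 mon_mul).
have [[i [m dE]]|[i [j [ij di dj]]]] := degree_cases d.
  rewrite dE in hb hc *; have [u [c0 [c1 [ud ->]]]] := one_variable (psi_power i m) hb hc.
  rewrite !linearD !linearZ /=; apply: (PD _ _ (PD _ _ _ _)) => //; try exact: PZ.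
  by rewrite -dE thetaB ?dE //; apply: Pb.
have ac := acyclic_neq1 (d := subd d (unitd i)) (psi_neq1 ij di dj).
rewrite subd_unitK // in ac; have [u ud <-] := ac _ hb hc.
by rewrite thetaB.
Qed.

Lemma subd0 d : subd d 0 = d.
Proof. by apply/ffunP => j; rewrite ffunE zerod subn0. Qed.

Lemma theta_nil d n : n != 0%N -> theta d n (bw [::]) = 0.
Proof. by move=> n0; rewrite thetaE /thetaw eq_sym (negPf n0). Qed.

Lemma theta_single d n a : n != 1%N -> theta d n (bw [:: a]) = 0.
Proof. by move=> n1; rewrite thetaE /thetaw eq_sym (negPf n1). Qed.

Lemma theta_chain0 i m : exists c,
  theta (unitd i *+ m) 0 (bw [::]) = c *: chain0 (x i ^+ m).
Proof.
rewrite thetaE /thetaw /= wsum_nil subd0; set c := (lam _ _)^-1; exists c.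
congr (_ *: tensor _); apply/ffunP => j.
by rewrite !ffunE ord1 /= mon_power.
Qed.

Lemma theta_chain1 i m : exists c m',
  theta (unitd i *+ m) 1 (bw [:: unitd i]) = c *: chain1 (x i ^+ m') (x i).
Proof.
rewrite thetaE /thetaw /= wsum_cons wsum_nil addr0.
set c := (lam _ _)^-1; exists c, m.-1.
congr (_ *: tensor _); apply/ffunP => j; rewrite !ffunE.
case: eqP => [->|/eqP]; last first.
  case: j => -[|[|//]] //= _ _; by rewrite -[unitd i]mulr1n mon_power expr1.
have -> : subd (unitd i *+ m) (unitd i) = unitd i *+ m.-1.
  by apply/ffunP => l; rewrite ffunE !mulnd ffunE; case: eqP; lia.
by rewrite /= mon_power.
Qed.

Lemma mon_unit i : mon (unitd i) = x i.
Proof. by rewrite -[unitd i]mulr1n mon_power expr1. Qed.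

(** Value on x^a of the algebra map to k[X] that sends x_i to X and the other
generators to 0. *)
Definition evp i a : {poly k} :=
  if [forall j, (j != i) ==> (a j == 0%N)] then 'X^(a i) else 0.

Definition eps i (z : A) : {poly k} := fext (evp i) (crd z).

Lemma eps_linear i : linear (eps i).
Proof. by move=> c y z; rewrite /eps !linearP. Qed.

HB.instance Definition _ i := GRing.isLinear.Build k A {poly k} *:%R (eps i)
  (eps_linear i).

Lemma eps_mon i a : eps i (mon a) = evp i a.
Proof. by rewrite /eps crd_mon fextE. Qed.

(** The right side vanishes unless a and b are multiples of e_i, and then no
generators are exchanged in x^a x^b. *)
Lemma evpD i a b : coc Lambda a b *: evp i (a + b) = evp i a * evp i b.
Proof.
rewrite /evp; case: (boolP [forall j, (j != i) ==> (a j == 0%N)]) => [/forallP ha|ha]; last first.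
  rewrite mul0r ifF ?scaler0 //; apply: contraNF ha => /forallP h.
  apply/forallP => j; apply/implyP => /(implyP (h j)).
  by rewrite addd addn_eq0 => /andP [].
case: (boolP [forall j, (j != i) ==> (b j == 0%N)]) => [/forallP hb|hb]; last first.
  rewrite mulr0 ifF ?scaler0 //; apply: contraNF hb => /forallP h.
  apply/forallP => j; apply/implyP => /(implyP (h j)).
  by rewrite addd addn_eq0 => /andP [].
have -> : coc Lambda a b = 1.
  rewrite /coc /dchar big1 // => j _.
  have [->|ji] := eqVneq j i; last by rewrite (eqP (implyP (ha j) ji)) expr0.
  rewrite /lowc big1 ?expr1n // => l li.
  rewrite (eqP (implyP (hb l) _)) ?expr0 //.
  by apply: contraTneq li => ->; rewrite ltnn.
rewrite ifT ?scale1r ?addd ?exprD //.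
apply/forallP => j; apply/implyP => ji.
by rewrite addd (eqP (implyP (ha j) ji)) (eqP (implyP (hb j) ji)).
Qed.

Lemma epsM i y z : eps i (y * z) = eps i y * eps i z.
Proof.
apply: (bilinear_mult (fw := mon) (phi := eps i) (star := fun p q => p * q)).
- by move=> h c p q; rewrite mulrDr scalerAr.
- by move=> h c p q; rewrite mulrDl scalerAl.
- move=> f; exists (fsupp (crd f)), (fun a => fcoef a (crd f)).
  exact: mon_span.
by move=> a b; rewrite mon_mul linearZ /= !eps_mon evpD.
Qed.

Lemma eps1 i : eps i 1 = 1.
Proof.
rewrite -(mon0 x) eps_mon /evp zerod expr0 ifT //.
by apply/forallP => j; rewrite zerod eqxx implybT.
Qed.

Lemma eps_gen i j : eps i (x j) = if j == i then 'X else 0.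
Proof.
rewrite -mon_unit eps_mon /evp ffunE.
case: eqVneq => [->|ji].
  rewrite ?eqxx expr1 ifT //; apply/forallP => l; rewrite ffunE.
  by case: eqVneq.
rewrite ifF //; apply/negP => /forallP /(_ j).
by rewrite eq_sym ji ffunE eqxx.
Qed.

Lemma eps_horner i j (p : {poly k}) :
  eps i (horner_alg (x j) p) = if j == i then p else (p`_0)%:P.
Proof.
elim/poly_ind: p => [|p c IH].
  by rewrite !linear0 coef0 polyC0 if_same.
rewrite rmorphD rmorphM /= horner_algX horner_algC linearD /= epsM IH.
rewrite linearZ /= eps1 alg_polyC eps_gen coefD coefMX coefC /= add0r.
by case: eqP; rewrite ?mulr0 ?add0r.
Qed.

Definition probe0 i : hchain A 0 -> {poly k} :=
  tlift (fun f : {ffun 'I_1 -> A} => eps i (f ord0)).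

Lemma probe0_multilinear i : multilinear (fun f : {ffun 'I_1 -> A} => eps i (f ord0)).
Proof. by move=> f j c y z; rewrite !ffunE !ord1 eqxx linearP. Qed.

HB.instance Definition _ i := GRing.isLinear.Build k (hchain A 0) {poly k} *:%R
  (probe0 i) (tlift_linear (probe0_multilinear i)).

Lemma probe0_chain i y : probe0 i (chain0 y) = eps i y.
Proof. by rewrite /probe0 (tlift_tensor (probe0_multilinear i)) ffunE. Qed.

(** The target of eps i is commutative. *)
Lemma probe0_bdry i y : probe0 i (hbdry y) = 0.
Proof.
apply: bdry_vanish => a; rewrite hbdry_tensor !big_ord_recl big_ord0 addr0.
rewrite linearD !linearZ /= /probe0 !(tlift_tensor (probe0_multilinear i)) !ffunE /=.
rewrite !epsM expr0 scale1r expr1 scaleN1r [X in _ - X]mulrC.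
rewrite (_ : widen_ord _ ord0 = ord0); last exact: val_inj.
by rewrite (_ : lift ord0 ord0 = ord_max) ?subrr //; exact: val_inj.
Qed.

Definition dpair i (f : {ffun 'I_2 -> A}) : {poly k} :=
  eps i (f ord0) * (eps i (f ord_max))^`().

Lemma dpair_multilinear i : multilinear (dpair i).
Proof.
move=> f j c y z; rewrite /dpair !ffunE.
have [->|->] : j = ord0 \/ j = ord_max :> 'I_2.
  by case: j => -[|[|//]] jl; [left|right]; apply: val_inj.
  by rewrite /= linearP mulrDl scalerAl.
by rewrite /= linearP linearP mulrDr scalerAr.
Qed.

Definition probe1 i : hchain A 1 -> {poly k} := tlift (dpair i).

HB.instance Definition _ i := GRing.isLinear.Build k (hchain A 1) {poly k} *:%R
  (probe1 i) (tlift_linear (dpair_multilinear i)).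

Lemma probe1_chain i y z : probe1 i (chain1 y z) = eps i y * (eps i z)^`().
Proof. by rewrite /probe1 (tlift_tensor (dpair_multilinear i)) /dpair !ffunE. Qed.

(** The Leibniz rule. *)
Lemma probe1_bdry i y : probe1 i (hbdry y) = 0.
Proof.
apply: bdry_vanish => a; rewrite hbdry_tensor !big_ord_recl big_ord0 addr0.
rewrite !linearD !linearZ /= /probe1 !(tlift_tensor (dpair_multilinear i)).
rewrite /dpair !ffunE /= !epsM !derivM.
have -> : widen_ord (leqnSn 2) ord0 = ord0 by apply: val_inj.
have -> : widen_ord (leqnSn 2) ord_max = lift ord0 ord0 by apply: val_inj.
have -> : lift ord0 (ord_max : 'I_2) = ord_max by apply: val_inj.
rewrite /bump /= expr0 expr1 sqrrN expr1n !scale1r scaleN1r; ring.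
Qed.

Lemma chain0_linear : linear (@chain0 k A).
Proof.
move=> c y z; have e (r : A) : chain0 r = tensor (upd [ffun=> 0] ord0 r).
  by congr tensor; apply/ffunP => j; rewrite !ffunE ord1 eqxx.
by rewrite !e tensor_multilinear.
Qed.

Lemma chain1_linear z : linear (fun y => @chain1 k A y z).
Proof.
move=> c y y'; have e (r : A) : chain1 r z =
    tensor (upd [ffun j : 'I_2 => if j == ord0 then 0 else z] ord0 r).
  by congr tensor; apply/ffunP => j; rewrite !ffunE; case: eqP.
by rewrite !e tensor_multilinear.
Qed.

Lemma chain1_bdry y z : y * z = z * y -> @hbdry k A 0 (chain1 y z) = 0.
Proof.
move=> yz; rewrite hbdry_tensor !big_ord_recl big_ord0 addr0.
rewrite expr0 expr1 scale1r scaleN1r; apply/eqP; rewrite subr_eq0.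
apply/eqP; congr tensor; apply/ffunP => j; rewrite !ffunE /=.
by rewrite ord1 /= yz.
Qed.

(** Reduces the surjectivity of t on classes to the two exceptional words. *)
Lemma cycles_spanned n (V : lmodType k) (t : V -> hchain A n) : linear t ->
    (forall i m, exists u y, theta (unitd i *+ m) n (bw [::]) = t u + hbdry y) ->
    (forall i m, exists u y,
      theta (unitd i *+ m) n (bw [:: unitd i]) = t u + hbdry y) ->
  forall z, z \in @hcycle_pred k A n -> exists u y, z = t u + hbdry y.
Proof.
move=> tL t1 t2; have t0 := linear_map0 tL.
have b0 : @hbdry k A n 0 = 0 := linear0 (@hbdry k A n).
apply: cycle_ind => //.
- by exists 0, 0; rewrite t0 b0 addr0.
- move=> c z z' [u [y ->]] [u' [y' ->]]; exists (c *: u + u'), (c *: y + y').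
  by rewrite tL hbdry_linear scalerDr addrACA.
- by move=> y; exists 0, y; rewrite t0 add0r.
Qed.

Lemma horner_gen_comm i (p : {poly k}) :
  horner_alg (x i) p * x i = x i * horner_alg (x i) p.
Proof. by rewrite -{2 3}[x i]horner_algX -!rmorphM mulrC. Qed.

Lemma horner_Xn i m : horner_alg (x i) 'X^m = x i ^+ m.
Proof. by rewrite rmorphXn /= horner_algX. Qed.

Lemma horner_algP (y : A) c p q :
  horner_alg y (c *: p + q) = c *: horner_alg y p + horner_alg y q.
Proof. by rewrite linearD linearZ /= mulr_algl. Qed.

Lemma xpoly_val_linear (c : k) (p q : xpoly k) :
  xpoly_val (c *: p + q) = c *: xpoly_val p + xpoly_val q.
Proof. exact: (linearP (val : {linear xpoly k -> {poly k}})). Qed.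

Lemma xpoly_coef0 (p : xpoly k) : (val p)`_0 = 0.
Proof.
case: p => p /= pX; have : 'X %| p by [].
by rewrite -['X]subr0 -polyC0 dvdp_XsubCl => /rootP; rewrite horner_coef0.
Qed.

Lemma Xn_xpoly m : ('X^(m.+1) : {poly k}) \in @xpoly_pred k.
Proof. by rewrite unfold_in exprS dvdp_mulIl. Qed.

Definition HH0_chain (u : (k^o * {ffun 'I_nu -> xpoly k})%type) : hchain A 0 :=
  chain0 (u.1 *: 1 + \sum_(i < nu) horner_alg (x i) (u.2 i)).

Lemma HH0_chain_linear : linear HH0_chain.
Proof.
move=> c u v; rewrite /HH0_chain -chain0_linear; congr chain0.
rewrite scalerDr scaler_sumr addrACA -big_split /= scalerDl scalerA.
congr (_ + _); apply: eq_bigr => i _.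
by rewrite !ffunE xpoly_val_linear horner_algP.
Qed.

Lemma HH0_affine : HH_iso_by HH0_chain.
Proof.
apply: HH_iso_of => [|//|u y uy|]; first exact: HH0_chain_linear.
  have e i : (u.1 : k)%:P + val (u.2 i) = 0.
    have := congr1 (probe0 i) uy; rewrite probe0_bdry probe0_chain linearD linear_sum /=.
    rewrite linearZ /= eps1 alg_polyC (bigD1 i) //= eps_horner eqxx big1 ?addr0 //.
    by move=> j /negPf ji; rewrite eps_horner ji xpoly_coef0 polyC0.
  have u1 : u.1 = 0.
    have := congr1 (fun p : {poly k} => p`_0) (e (Ordinal nu_gt0)).
    by rewrite coefD coefC /= xpoly_coef0 addr0 coef0.
  case: u u1 e {uy} => u1 u2 /= -> e; congr (_, _); apply/ffunP => i.
  by apply: val_inj; have := e i; rewrite polyC0 add0r ffunE.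
apply: cycles_spanned; first exact: HH0_chain_linear.
- move=> i m; have [c ->] := theta_chain0 i m.
  suff [u <-] : exists u, HH0_chain u = chain0 (x i ^+ m).
    exists (c *: u), 0; rewrite (linear0 (@hbdry k A 0)) addr0.
    by rewrite -[c *: u]addr0 HH0_chain_linear (linear_map0 HH0_chain_linear) addr0.
  case: m => [|m].
    exists (1, 0); rewrite /HH0_chain /= scale1r expr0 big1 ?addr0 // => j _.
    by rewrite ffunE linear0.
  exists (0, [ffun j => if j == i then XPoly (Xn_xpoly m) else 0]).
  rewrite /HH0_chain /= scale0r add0r (bigD1 i) //= ffunE eqxx big1 ?addr0.
    by rewrite horner_Xn.
  by move=> j /negPf ji; rewrite ffunE ji linear0.
move=> i m; exists 0, 0; rewrite theta_single // (linear0 (@hbdry k A 0)) addr0.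
by rewrite (linear_map0 HH0_chain_linear).
Qed.

Definition HH1_chain (u : {ffun 'I_nu -> {poly k}}) : hchain A 1 :=
  \sum_(i < nu) chain1 (horner_alg (x i) (u i)) (x i).

Lemma HH1_chain_linear : linear HH1_chain.
Proof.
move=> c u v; rewrite /HH1_chain scaler_sumr -big_split; apply: eq_bigr => i _ /=.
by rewrite !ffunE horner_algP; exact: chain1_linear.
Qed.

Lemma HH1_affine : HH_iso_by HH1_chain.
Proof.
apply: HH_iso_of => [|u|u y uy|]; first exact: HH1_chain_linear.
- rewrite unfold_in /= /HH1_chain (linear_sum (@hbdry k A 0)) big1 // => i _.
  by apply: chain1_bdry; exact: horner_gen_comm.
- apply/ffunP => i; rewrite ffunE.
  have := congr1 (probe1 i) uy; rewrite probe1_bdry linear_sum /= (bigD1 i) //=.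
  rewrite probe1_chain eps_gen eqxx derivX mulr1 eps_horner eqxx big1 ?addr0 //.
  by move=> j /negPf ji; rewrite probe1_chain eps_gen ji deriv0 mulr0.
have t10 := linear_map0 HH1_chain_linear.
apply: cycles_spanned; first exact: HH1_chain_linear.
  move=> i m; exists 0, 0; rewrite theta_nil // (linear0 (@hbdry k A 1)) addr0.
  by rewrite t10.
move=> i m; have [c [m' ->]] := theta_chain1 i m.
exists (c *: [ffun j => if j == i then 'X^m' else 0]), 0.
rewrite (linear0 (@hbdry k A 1)) addr0 -[c *: [ffun _ => _]]addr0 HH1_chain_linear t10 addr0.
congr (_ *: _); rewrite /HH1_chain (bigD1 i) //= ffunE eqxx horner_Xn big1 ?addr0 //.
move=> j /negPf ji; rewrite ffunE ji linear0.
exact: linear_map0 (chain1_linear (x j)).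
Qed.

Lemma HHn_affine n (h : HH A n) : (2 <= n)%N -> h = 0.
Proof.
move=> n2; apply: HH_eq0; apply: cycle_ind => //.
- by exists 0; rewrite (linear0 (@hbdry k A n)).
- by move=> c y z [y' ->] [z' ->]; exists (c *: y' + z'); rewrite hbdry_linear.
- by move=> y; exists y.
- move=> i m; exists 0; rewrite theta_nil ?(linear0 (@hbdry k A n)) //.
  by case: n n2 {h}.
move=> i m; exists 0; rewrite theta_single ?(linear0 (@hbdry k A n)) //.
by case: n n2 {h} => [|[]].
Qed.

End Homology.

(** * Independence of the parameters *)
Section Independence.
Variable k : fieldType.

(** A generating family of size r of a free abelian group of rank r is a basis: the
matrix U of the generators has a left inverse N over the integers, which is
also a right inverse because both are square. *)
Lemma free_generators_independent (T : finType) (B : {pred T}) (q : T -> k)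
    (S : k -> Prop) :
    (forall p, p \in B -> S (q p)) ->
    (forall y, S y -> y = 1 \/ exists2 p, p \in B & y = q p \/ y = (q p)^-1) ->
    free_abelian_of_rank (mulgen S) #|B| ->
  forall n : T -> int, \prod_(p in B) q p ^ n p = 1 ->
  forall p, p \in B -> n p = 0.
Proof.
move=> qS Sq [f [f0 fD f_inj fG]] n qn p pB.
have fN u : f (- u) = (f u)^-1.
  have e : f u * f (- u) = 1 by rewrite -fD subrr f0.
  have fu : f u != 0 by apply: contra_eq_neq e => ->; rewrite mul0r eq_sym oner_eq0.
  by rewrite -[RHS]mulr1 -e mulKf.
have fZ (z : int) u : f (z *: u) = f u ^ z.
  have fZn m : f (m%:Z *: u) = f u ^+ m.
    elim: m => [|m IH]; first by rewrite scale0r f0 expr0.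
    by rewrite intS scalerDl scale1r fD IH exprS.
  by case: z => m; rewrite ?NegzE ?scaleNr ?fN fZn.
have fsum (I : finType) (u : I -> 'rV[int]_#|B|) :
    f (\sum_i u i) = \prod_i f (u i).
  by elim/big_rec2: _ => [|i y z _ <-]; rewrite ?f0 ?fD.
have u_ex j : exists u, f u = q (enum_val (A := B) j).
  by apply/fG/mulgen_in/qS/enum_valP.
pose U := \matrix_j sval (cid (u_ex j)).
have fU j : f (row j U) = q (enum_val j) by rewrite rowK; exact: svalP (cid (u_ex j)).
have span y : mulgen S y -> exists v, f (v *m U) = y.
  elim=> [z /Sq [->|[p' p'B zE]]||z z' _ [v <-] _ [v' <-]|z _ [v <-]].
  - by exists 0; rewrite mul0mx f0.
  - pose j := enum_rank_in p'B p'.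
    have fj : f (delta_mx 0 j *m U) = q p' by rewrite -rowE fU enum_rankK_in.
    case: zE => ->; first by exists (delta_mx 0 j).
    by exists (- delta_mx 0 j); rewrite mulNmx fN fj.
  - by exists 0; rewrite mul0mx f0.
  - by exists (v + v'); rewrite mulmxDl fD.
  - by exists (- v); rewrite mulNmx fN.
have v_ex j : exists v, f (v *m U) = f (delta_mx 0 j) :> k.
  by apply: span; apply/fG; exists (delta_mx 0 j).
pose N := \matrix_j sval (cid (v_ex j)).
have NU : N *m U = 1%:M.
  apply/row_matrixP => j; rewrite row_mul rowK row1.
  by apply: f_inj; exact: svalP (cid (v_ex j)).
have UN := mulmx1C NU.
pose v : 'rV[int]_#|B| := \row_j n (enum_val j).
have vU : v *m U = 0.
  apply: f_inj; rewrite f0 -qn mulmx_sum_row fsum [RHS]big_enum_val /=.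
  by apply: eq_bigr => j _; rewrite fZ fU mxE.
have v0 : v = 0 by rewrite -[v]mulmx1 -UN mulmxA vU mul0mx.
have := congr1 (fun w : 'rV_#|B| => w 0 (enum_rank_in pB p)) v0.
by rewrite !mxE enum_rankK_in.
Qed.

Lemma card_ordered_pairs nu :
  #|[pred p : 'I_nu * 'I_nu | (p.1 < p.2)%N]| = ((nu * (nu - 1)) %/ 2)%N.
Proof.
rewrite divn2 subn1 -bin2 -bin2_sum -sum1_card.
rewrite -(pair_big_dep predT (fun i j : 'I_nu => (i < j)%N) (fun _ _ => 1%N)) /=.
rewrite (exchange_big_dep predT) //= big_mkord; apply: eq_bigr => j _.
by rewrite -(big_ord_widen nu (fun=> 1%N) (ltnW (ltn_ord j))) sum1_card card_ord.
Qed.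

Variables (nu : nat) (Lambda : 'M[k]_nu).
Hypothesis Lambda_neq0 : forall i j, Lambda i j != 0.
Hypothesis Lambda_diag : forall i, Lambda i i = 1.
Hypothesis Lambda_inv :
  forall i j : 'I_nu, (i < j)%N -> Lambda i j * Lambda j i = 1.
Hypothesis Lambda_free : free_abelian_of_rank
  (mulgen (fun y => exists i j, y = Lambda i j)) ((nu * (nu - 1)) %/ 2)%N.

Lemma Lambda_independent (n : 'I_nu * 'I_nu -> int) :
    \prod_(p : 'I_nu * 'I_nu | (p.1 < p.2)%N) Lambda p.1 p.2 ^ n p = 1 ->
  forall i j : 'I_nu, (i < j)%N -> n (i, j) = 0.
Proof.
move=> n1 i j ij; move: Lambda_free; rewrite -card_ordered_pairs => fr.
apply: (free_generators_independent (q := fun p => Lambda p.1 p.2) _ _ fr n1) => //.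
  by move=> p _; exists p.1, p.2.
move=> _ [l [m ->]]; case: (ltngtP l m) => [lm|ml|/val_inj ->].
- by right; exists (l, m) => //; left.
- right; exists (m, l) => //; right => /=.
  by apply: (mulfI (Lambda_neq0 m l)); rewrite Lambda_inv // mulfV.
- by left; rewrite Lambda_diag.
Qed.

(** psi d i is the product of the Lambda l m with l < m, each to the power d l if
m = i, - d m if l = i, and 0 otherwise; the exponent d j or - d j that
belongs to the pair of i and j is not 0. *)
Lemma psi_neq1 (d : {ffun 'I_nu -> nat}) i j :
  i != j -> (0 < d i)%N -> (0 < d j)%N -> psi Lambda d i != 1.
Proof.
move=> ij di dj; apply/eqP => psi1.
pose m1 (p : 'I_nu * 'I_nu) : nat := if p.2 == i then d p.1 else 0%N.
pose m2 (p : 'I_nu * 'I_nu) : nat := if p.1 == i then d p.2 else 0%N.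
have prod1 : \prod_(p : 'I_nu * 'I_nu | (p.1 < p.2)%N) Lambda p.1 p.2 ^+ m1 p =
    lowc Lambda d i.
  rewrite -(pair_big_dep predT (fun l m : 'I_nu => (l < m)%N)
    (fun l m => Lambda l m ^+ m1 (l, m))) /=.
  rewrite (exchange_big_dep predT) //= (bigD1 i) //= [X in _ * X]big1 ?mulr1.
    by apply: eq_bigr => l _; rewrite /m1 eqxx.
  by move=> m /negPf mi; apply: big1 => l _; rewrite /m1 /= mi expr0.
have prod2 : \prod_(p : 'I_nu * 'I_nu | (p.1 < p.2)%N) Lambda p.1 p.2 ^+ m2 p =
    highc Lambda d i.
  rewrite -(pair_big_dep predT (fun l m : 'I_nu => (l < m)%N)
    (fun l m => Lambda l m ^+ m2 (l, m))) /=.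
  rewrite (bigD1 i) //= [X in _ * X]big1 ?mulr1.
    by apply: eq_bigr => l _; rewrite /m2 eqxx.
  by move=> m /negPf mi; apply: big1 => l _; rewrite /m2 /= mi expr0.
have n1 : \prod_(p : 'I_nu * 'I_nu | (p.1 < p.2)%N)
    Lambda p.1 p.2 ^ ((m1 p)%:Z - (m2 p)%:Z) = 1.
  rewrite -[RHS]psi1 /psi -prod1 -prod2 -prodf_div; apply: eq_bigr => p _.
  by rewrite expfzDr ?Lambda_neq0 // exprnN.
case: (ltngtP i j) => [lij|lji|/val_inj e]; last by rewrite e eqxx in ij.
  have := Lambda_independent n1 lij; rewrite /m1 /m2 /= eqxx.
  by rewrite eq_sym (negPf ij); lia.
have := Lambda_independent n1 lji; rewrite /m1 /m2 /= eqxx.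
by rewrite eq_sym (negPf ij); lia.
Qed.

End Independence.

(** * Hochschild homology of the multiparametric affine space *)
Theorem mainTheorem7 (k : fieldType) (nu : nat) (Lambda : 'M[k]_nu)
    (char_k : [pchar k] =i pred0)
    (nu_ge1 : (1 <= nu)%N)
    (Lambda_neq0 : forall i j, Lambda i j != 0)
    (Lambda_diag : forall i, Lambda i i = 1)
    (Lambda_inv : forall i j : 'I_nu, (i < j)%N -> Lambda i j * Lambda j i = 1)
    (Lambda_free : free_abelian_of_rank
       (mulgen (fun y => exists i j, y = Lambda i j)) ((nu * (nu - 1)) %/ 2)%N) :
  let S : algType k := affine_space Lambda in
  let x : 'I_nu -> S := aff_gen Lambda in
  [/\ HH_iso_by (fun u : (k^o * {ffun 'I_nu -> xpoly k})%type =>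
        chain0 (u.1 *: 1 + \sum_(i < nu) horner_alg (x i) (u.2 i) : S)),
      HH_iso_by (fun u : {ffun 'I_nu -> {poly k}} =>
        \sum_(i < nu) chain1 (horner_alg (x i) (u i)) (x i)) &
      forall n, (2 <= n)%N -> forall z : HH S n, z = 0].
Proof.
move=> S x.
have x_rel i j : x j * x i = Lambda i j *: (x i * x j) := aff_gen_rel Lambda i j.
pose crd : {linear S -> fmod k {ffun 'I_nu -> nat}} :=
  affine_coord Lambda_diag Lambda_inv.
have crd_mon a : crd (mon x a) = fb k a := coord_amon Lambda_neq0 Lambda_diag Lambda_inv a.
have mon_crd z : fext (mon x) (crd z) = z := amon_coord z.
have psi1 := psi_neq1 Lambda_neq0 Lambda_diag Lambda_inv Lambda_free.
split.
- by have := HH0_affine nu_ge1 Lambda_neq0 x_rel crd_mon mon_crd psi1.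
- by have := HH1_affine nu_ge1 Lambda_neq0 x_rel crd_mon mon_crd psi1.
have := HHn_affine nu_ge1 Lambda_neq0 x_rel crd_mon mon_crd psi1.
by move=> HHn n n2 z; exact: (HHn n z n2).
Qed.
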